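(* Let $X$ be a Banach space. The following assertions are equivalent: (i) There is $C>0$ such that $\operatorname{cc}(T^* )\le C\operatorname{wk}_X(T)$ for any operator $T$ from a Banach space $Y$ to $X$. (ii) There is $C>0$ such that $\operatorname{cc}(T^* )\le C\operatorname{wk}_X(T)$ for any operator $T$ from $\ell_1$ to $X$. (iii) There is $C>0$ such that $\limsup_n|x_n^*(x_n)|\le C\operatorname{wk}_X(\{x_n:n\in\mathbb N\})$ whenever $(x_n)$ is a bounded sequence in $X$ and $(x_n^* )$ is a weakly null sequence in $B_{X^*}$. (iv) There is $C>0$ such that $\operatorname{ca}_{\rho}(x_n)\le C\delta(x_n)$ for any bounded sequence $(x_n)$ in $X$. (v) There is $C>0$ such that $\widetilde{\operatorname{ca}}_{\rho}(x_n)\le C\operatorname{wk}_X(\{x_n:n\in\mathbb N\})$ for any bounded sequence $(x_n)$ in $X$.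
   Context: Banach spaces are real or complex; $B_X$ is the closed unit ball; operator means bounded linear operator. For a bounded sequence $(z_k)$ in a Banach space, $\operatorname{ca}(z_k)=\inf_{n}\sup_{k,l\ge n}\|z_k-z_l\|$. For an operator $S:Z\to W$ between Banach spaces, $\operatorname{cc}(S)=\sup\{\operatorname{ca}(Sz_k):(z_k)\text{ is a weakly Cauchy sequence in }B_Z\}$. For a bounded subset $A$ of a Banach space $X$, $\operatorname{wk}_X(A)=\sup\{\operatorname{dist}(x^{**},X):x^{**}\in\overline{A}^{w^*}\}$, where $\overline{A}^{w^*}$ is the weak$^*$ closure of $A$ in $X^{**}$ and $X$ is canonically embedded in $X^{**}$. For an operator $T:Y\to X$, $\operatorname{wk}_X(T)=\operatorname{wk}_X(T(B_Y))$. For a bounded sequence $(x_n)$ in $X$, $\delta(x_n)=\sup_{F}\inf_{n_0}\sup_{i,j\ge n_0}\sup_{x^*\in F}|x^*(x_i-x_j)|$, the first supremum over finite $F\subset B_{X^*}$ (equivalently, the diameter of the set of weak$^*$ cluster points of $(x_n)$ in $X^{**}$), and $$\operatorname{ca}_\rho(x_n)=\sup_{F}\inf_{n_0}\sup_{i,j\ge n_0}\sup_{x^*\in F}|x^*(x_i-x_j)|,$$ the first supremum over all weakly compact $F\subset B_{X^*}$; $\widetilde{\operatorname{ca}}_{\rho}(x_n)$ is the infimum of $\operatorname{ca}_{\rho}$ over all subsequences of $(x_n)$. *)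

(* Defs.v *)
From HB Require Import structures.
From mathcomp Require Import all_boot all_order all_algebra.
From mathcomp Require Import complex.
From mathcomp Require Import all_classical all_reals all_analysis.

Set Implicit Arguments.
Unset Strict Implicit.
Unset Printing Implicit Defensive.

Import Order.TTheory GRing.Theory Num.Theory.
Import numFieldNormedType.Exports.

Local Open Scope classical_set_scope.
Local Open Scope ring_scope.

Variant scalar_kind := RealScalars | ComplexScalars.

(* The scalar field of a Banach space, R or C, as a numFieldType, so that one
   normedModType (scalarField R k) covers the real and the complex case. *)
Definition scalarField (R : realType) (k : scalar_kind) : numFieldType :=
  match k with
  | RealScalars => R
  | ComplexScalars => R[i]
  end.

Definition scalar_of_real (R : realType) (k : scalar_kind) : R -> scalarField R k :=
  match k with
  | RealScalars => fun x => x
  | ComplexScalars => fun x => x%:C%C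
  end.

Definition re (R : realType) (k : scalar_kind) : scalarField R k -> R :=
  match k with
  | RealScalars => fun x => x
  | ComplexScalars => fun x => complex.Re x
  end.

Section scalar_theory.
Context {R : realType} {k : scalar_kind}.
Local Notation K := (scalarField R k).
Local Notation emb := (@scalar_of_real R k).

Lemma embK : cancel emb (@re R k).
Proof. by case: k. Qed.

Lemma emb0 : emb 0 = 0. Proof. by case: k. Qed.
Lemma emb1 : emb 1 = 1. Proof. by case: k. Qed.
Lemma embD x y : emb (x + y) = emb x + emb y.
Proof. by case: k => //=; rewrite rmorphD. Qed.
Lemma embM x y : emb (x * y) = emb x * emb y.
Proof. by case: k => //=; rewrite rmorphM. Qed.
Lemma ler_emb x y : (emb x <= emb y) = (x <= y).
Proof. by case: k => //=; rewrite lecR. Qed.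
Lemma ltr_emb x y : (emb x < emb y) = (x < y).
Proof. by case: k => //=; rewrite ltcR. Qed.

Lemma emb_re (x : K) : 0 <= x -> emb (re x) = x.
Proof. by case: k x => //= -[a b]; rewrite lecE /= => /andP[/eqP ->]. Qed.

Lemma re0 : re (0 : K) = 0. Proof. by rewrite -emb0 embK. Qed.
Lemma re1 : re (1 : K) = 1. Proof. by rewrite -emb1 embK. Qed.
Lemma ler_re (x y : K) : 0 <= x -> 0 <= y -> (re x <= re y) = (x <= y).
Proof. by move=> x0 y0; rewrite -ler_emb !emb_re. Qed.
Lemma re_ge0 (x : K) : 0 <= x -> 0 <= re x.
Proof. by move=> x0; rewrite -ler_emb emb_re// emb0. Qed.
Lemma reM (x y : K) : 0 <= x -> 0 <= y -> re (x * y) = re x * re y.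
Proof. by move=> x0 y0; rewrite -[LHS]embK -{1}(emb_re x0) -{1}(emb_re y0) -embM !embK. Qed.
Lemma reD (x y : K) : 0 <= x -> 0 <= y -> re (x + y) = re x + re y.
Proof. by move=> x0 y0; rewrite -{1}(emb_re x0) -{1}(emb_re y0) -embD !embK. Qed.

End scalar_theory.

(* `|x| lives in the scalar field; nrm x is the same number as an element of R. *)
Definition nrm (R : realType) (k : scalar_kind)
  (V : normedZmodType (scalarField R k)) (x : V) : R := re `|x|.

Section nrm_theory.
Context {R : realType} {k : scalar_kind}.
Local Notation K := (scalarField R k).
Implicit Types V : normedModType K.

Lemma nrm_ge0 V (x : V) : 0 <= nrm x.
Proof. by rewrite re_ge0. Qed.
Lemma emb_nrm V (x : V) : scalar_of_real k (nrm x) = `|x|.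
Proof. by rewrite emb_re. Qed.
Lemma nrm0 V : nrm (0 : V) = 0.
Proof. by rewrite /nrm normr0 re0. Qed.
Lemma nrm0_eq0 V (x : V) : nrm x = 0 -> x = 0.
Proof. by move=> x0; apply/normr0_eq0; rewrite -emb_nrm x0 emb0. Qed.
Lemma ler_nrmD V (x y : V) : nrm (x + y) <= nrm x + nrm y.
Proof. by rewrite -reD// ler_re// ?addr_ge0// ler_normD. Qed.
Lemma nrmZ V (a : K) (x : V) : nrm (a *: x) = nrm (a : K^o) * nrm x.
Proof. by rewrite /nrm normrZ reM. Qed.
Lemma nrm_le1 V (x : V) : (nrm x <= 1) = (`|x| <= 1).
Proof. by rewrite -emb_nrm -(@emb1 R k) ler_emb. Qed.

End nrm_theory.

Section blin.
Context {R : realType} {k : scalar_kind}.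
Local Notation K := (scalarField R k).
Variables X Y : normedModType K.

(* Bounded linear operators; for linear maps, bounded means continuous. *)
Definition blin_pred : {pred X -> Y} :=
  fun f => `[< linear f /\ continuous f >].

Lemma blin_pred_submod : submod_closed blin_pred.
Proof.
split.
  apply/asboolP; split; last exact: cst_continuous.
  by move=> a x y /=; rewrite scaler0 addr0.
move=> a f g /asboolP[lf cf] /asboolP[lg cg]; apply/asboolP; split.
  move=> b x y; rewrite !fctE /= lf lg !scalerDr !scalerA [a * b]mulrC.
  by rewrite addrACA.
move=> x; apply: continuousD; last exact: cg.
by apply: continuousZl_tmp; exact: cf.
Qed.

HB.instance Definition _ := GRing.isSubmodClosed.Build K (X -> Y) blin_pred
  blin_pred_submod.

Record blin := Blin { blin_fun :> X -> Y ; blinP : blin_fun \in blin_pred }.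
HB.instance Definition _ := [isSub for blin_fun].
HB.instance Definition _ := [Choice of blin by <:].
HB.instance Definition _ := [SubChoice_isSubLmodule of blin by <:].

Lemma blin_is_linear (f : blin) : linear f.
Proof. by have /asboolP[] := blinP f. Qed.
Lemma blin_continuous (f : blin) : continuous f.
Proof. by have /asboolP[] := blinP f. Qed.
HB.instance Definition _ (f : blin) :=
  GRing.isLinear.Build K X Y *:%R (blin_fun f) (blin_is_linear f).

End blin.

Definition unit_ball (R : realType) (k : scalar_kind)
  (Z : normedModType (scalarField R k)) : set Z := [set z | `|z| <= 1].

Section opnorm.
Context {R : realType} {k : scalar_kind}.
Local Notation K := (scalarField R k).
Variables X Y : normedModType K.
Implicit Types f g : blin X Y.

Definition opnorm f : R := sup [set nrm (f x) | x in @unit_ball R k X].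

Lemma blin_bounded f : exists2 M : R, 0 <= M & forall x, nrm (f x) <= M * nrm x.
Proof.
have /linear_bounded_continuous/linear_boundedP/pinfty_ex_gt0[r r0 fr] :=
  @blin_continuous _ _ _ _ f.
exists (re r) => [|x]; first exact/re_ge0/ltW.
rewrite -reM//; last exact: ltW.
by rewrite ler_re//; [exact: fr|rewrite mulr_ge0// ltW].
Qed.

Lemma opnorm_has_sup f : has_sup [set nrm (f x) | x in @unit_ball R k X].
Proof.
split; first by exists (nrm (f 0)), 0 => //; rewrite /unit_ball /= normr0.
have [M M0 fM] := blin_bounded f; exists M => _ [x x1 <-].
by rewrite (le_trans (fM x))// ler_piMr// nrm_le1.
Qed.

Lemma opnorm_ub f x : `|x| <= 1 -> nrm (f x) <= opnorm f.
Proof. by move=> x1; apply: (sup_upper_bound (opnorm_has_sup f)); exists x. Qed.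

Lemma opnorm_le f M : (forall x, `|x| <= 1 -> nrm (f x) <= M) -> opnorm f <= M.
Proof.
move=> fM; apply: ge_sup; first by case: (opnorm_has_sup f).
by move=> _ [x x1 <-]; exact: fM.
Qed.

Lemma opnorm_ge0 f : 0 <= opnorm f.
Proof.
by rewrite (le_trans (nrm_ge0 (f 0)))// opnorm_ub// normr0.
Qed.

Lemma ler_opnorm f x : nrm (f x) <= opnorm f * nrm x.
Proof.
have [->|x0] := eqVneq x 0; first by rewrite linear0 !nrm0 mulr0.
have x0' : 0 < `|x| by rewrite normr_gt0.
have := @opnorm_ub f (`|x|^-1 *: x).
rewrite normfZV// => /(_ (lexx _)).
rewrite linearZ /= -(@ler_emb _ k) emb_nrm normrZ normfV normr_id => h.
by rewrite -(@ler_emb _ k) embM !emb_nrm mulrC -ler_pdivrMl.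
Qed.

Lemma opnormD f g : opnorm (f + g) <= opnorm f + opnorm g.
Proof.
apply: opnorm_le => x x1; rewrite (le_trans (ler_nrmD _ _))//.
by rewrite lerD// opnorm_ub.
Qed.

Lemma opnormZ_le (a : K) f : opnorm (a *: f) <= nrm (a : K^o) * opnorm f.
Proof.
apply: opnorm_le => x x1; rewrite [X in nrm X](_ : _ = a *: f x)//.
by rewrite nrmZ ler_wpM2l ?nrm_ge0// opnorm_ub.
Qed.

Lemma opnormZ (a : K) f : opnorm (a *: f) = nrm (a : K^o) * opnorm f.
Proof.
apply/eqP; rewrite eq_le opnormZ_le /=.
have [->|a0] := eqVneq a 0.
  by rewrite nrm0 mul0r opnorm_ge0.
have aa : nrm (a : K^o) * nrm (a^-1 : K^o) = 1.
  by rewrite -reM//= -normrM divff// normr1 re1.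
have -> : f = a^-1 *: (a *: f) by rewrite scalerA mulVf// scale1r.
rewrite (le_trans (ler_wpM2l (nrm_ge0 _) (opnormZ_le _ _)))//.
by rewrite mulrA aa mul1r scalerA mulfV// scale1r.
Qed.

Lemma opnorm_eq0 f : opnorm f = 0 -> f = 0.
Proof.
move=> f0; apply/val_inj/funext => x /=; apply: nrm0_eq0.
by apply/eqP; rewrite eq_le nrm_ge0 andbT (le_trans (ler_opnorm _ _))// f0 mul0r.
Qed.

Definition opnormK f : K := scalar_of_real k (opnorm f).

Lemma opnormKD f g : opnormK (f + g) <= opnormK f + opnormK g.
Proof. by rewrite -embD ler_emb opnormD. Qed.
Lemma opnormKZ (a : K) f : opnormK (a *: f) = `|a| * opnormK f.
Proof. by rewrite /opnormK opnormZ embM emb_nrm. Qed.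
Lemma opnormK_eq0 f : opnormK f = 0 -> f = 0.
Proof.
by move=> f0; apply: opnorm_eq0; rewrite -[LHS](@embK _ k) -[X in re X]/(opnormK f) f0 re0.
Qed.

HB.instance Definition _ := Lmodule_isNormed.Build K (blin X Y)
  opnormKD opnormKZ opnormK_eq0.

Lemma nrm_blinE f : nrm f = opnorm f.
Proof. exact: embK. Qed.

Lemma blin_bound (f : X -> Y) (M : R) : linear f ->
  (forall x, nrm (f x) <= M * nrm x) -> f \in @blin_pred R k X Y.
Proof.
move=> lf fM; apply/asboolP; split=> //.
pose L := GRing.isLinear.Build K X Y *:%R f lf.
pose F : {linear X -> Y} := HB.pack f L.
suff : continuous F by [].
apply/linear_bounded_continuous/linear_boundedP.
exists (scalar_of_real k M); split.
  by rewrite realE -(@emb0 R k) !ler_emb -realE num_real.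
move=> r Mr x; rewrite (@le_trans _ _ (scalar_of_real k M * `|x|))//.
  by rewrite -!emb_nrm -embM ler_emb fM.
by rewrite ler_wpM2r// ltW.
Qed.

End opnorm.

Notation dual X := (blin X (scalarField _ _)^o).

Section duality.
Context {R : realType} {k : scalar_kind}.
Local Notation K := (scalarField R k).

Section canonical_embedding.
Variable X : normedModType K.

Lemma evaluation_subproof (x : X) :
  (fun f : dual X => f x) \in @blin_pred R k (dual X) K^o.
Proof.
apply: (@blin_bound R k _ _ _ (nrm x)) => [a f g //|f].
by rewrite mulrC nrm_blinE ler_opnorm.
Qed.

Definition evaluation (x : X) : dual (dual X) := Blin (evaluation_subproof x).

End canonical_embedding.

Section adjoint.
Variables (Y X : normedModType K) (T : blin Y X).

Lemma comp_blin_subproof (f : dual X) : f \o T \in @blin_pred R k Y K^o.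
Proof.
apply/asboolP; split => [a x y /=|]; first by rewrite !linearP.
by move=> x; apply: continuous_comp; exact: blin_continuous.
Qed.

Lemma adjoint_subproof :
  (fun f : dual X => Blin (comp_blin_subproof f)) \in
  @blin_pred R k (dual X) (dual Y).
Proof.
apply: (@blin_bound R k _ _ _ (opnorm T)) => [a f g|f].
  exact/val_inj.
rewrite !nrm_blinE; apply: opnorm_le => y y1 /=.
rewrite (le_trans (ler_opnorm _ _))// mulrC ler_wpM2r ?opnorm_ge0//.
exact: opnorm_ub.
Qed.

Definition adjoint : blin (dual X) (dual Y) := Blin adjoint_subproof.

End adjoint.
End duality.

Section ell1.
Variables (R : realType) (k : scalar_kind).
Local Notation K := (scalarField R k).

Definition ell1_pred : {pred nat -> K^o} :=
  fun u => `[< cvgn (series (fun n => nrm (u n))) >].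

Lemma ell1_pred_submod : submod_closed ell1_pred.
Proof.
split.
  apply/asboolP; rewrite [X in series X](_ : _ = cst 0); last first.
    by apply/funext => n; rewrite nrm0.
  rewrite (_ : series _ = cst 0); first exact: is_cvg_cst.
  by apply/funext => n; rewrite /series /= big1.
move=> a u v /asboolP cu /asboolP cv; apply/asboolP.
apply: (@series_le_cvg _ _ (fun n => nrm (a : K^o) * nrm (u n) + nrm (v n))).
- by move=> n; exact: nrm_ge0.
- by move=> n; rewrite addr_ge0// ?mulr_ge0// nrm_ge0.
- by move=> n; rewrite (le_trans (ler_nrmD _ _))// nrmZ.
- rewrite [X in cvgn X](_ : _ = (fun n => nrm (a : K^o) *
      series (fun n => nrm (u n)) n + series (fun n => nrm (v n)) n)).
    by apply: is_cvgD => //; apply: is_cvgMr.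
  by apply/funext => n; rewrite /series /= big_split /= mulr_sumr.
Qed.

HB.instance Definition _ := GRing.isSubmodClosed.Build K (nat -> K^o) ell1_pred
  ell1_pred_submod.

Record ell1 := Ell1 { ell1_seq :> nat -> K^o ; ell1P : ell1_seq \in ell1_pred }.
HB.instance Definition _ := [isSub for ell1_seq].
HB.instance Definition _ := [Choice of ell1 by <:].
HB.instance Definition _ := [SubChoice_isSubLmodule of ell1 by <:].

Definition ell1_norm (u : ell1) : R := limn (series (fun n => nrm (u n))).

Lemma ell1_cvg (u : ell1) : cvgn (series (fun n => nrm (u n))).
Proof. by have /asboolP := ell1P u. Qed.

Lemma ell1_norm_le (u : ell1) n : nrm (u n) <= ell1_norm u.
Proof.
have nd : nondecreasing_seq (series (fun n => nrm (u n))).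
  by apply/nondecreasing_series => i _ _; exact: nrm_ge0.
rewrite (le_trans _ (nondecreasing_cvgn_le nd (@ell1_cvg u) n.+1))//.
rewrite seriesSr lerDr /series /=; by apply: sumr_ge0 => i _; exact: nrm_ge0.
Qed.

Lemma ell1_normD u v : ell1_norm (u + v) <= ell1_norm u + ell1_norm v.
Proof.
rewrite /ell1_norm -limD; [|exact: ell1_cvg|exact: ell1_cvg].
apply: ler_lim; [exact: ell1_cvg|by apply: is_cvgD; exact: ell1_cvg|].
apply: nearW => n; rewrite /series !fctE /= -big_split /=.
by apply: ler_sum => i _; exact: ler_nrmD.
Qed.

Lemma ell1_normZ (a : K) u : ell1_norm (a *: u) = nrm (a : K^o) * ell1_norm u.
Proof.
rewrite /ell1_norm -[RHS]lim_seriesZ; last exact: ell1_cvg.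
by congr (limn (series _)); apply/funext => n; exact: nrmZ.
Qed.

Lemma ell1_norm_eq0 u : ell1_norm u = 0 -> u = 0.
Proof.
move=> u0; apply/val_inj/funext => n /=; apply: nrm0_eq0.
by apply/eqP; rewrite eq_le nrm_ge0 andbT -u0 ell1_norm_le.
Qed.

Definition ell1_normK u : K := scalar_of_real k (ell1_norm u).

Lemma ell1_normKD u v : ell1_normK (u + v) <= ell1_normK u + ell1_normK v.
Proof. by rewrite -embD ler_emb ell1_normD. Qed.
Lemma ell1_normKZ (a : K) u : ell1_normK (a *: u) = `|a| * ell1_normK u.
Proof. by rewrite /ell1_normK ell1_normZ embM emb_nrm. Qed.
Lemma ell1_normK_eq0 u : ell1_normK u = 0 -> u = 0.
Proof.
by move=> u0; apply: ell1_norm_eq0; rewrite -[LHS](@embK _ k) -[X in re X]/(ell1_normK u) u0 re0.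
Qed.

HB.instance Definition _ := Lmodule_isNormed.Build K ell1
  ell1_normKD ell1_normKZ ell1_normK_eq0.

Lemma nrm_ell1E (u : ell1) : nrm u = ell1_norm u.
Proof. exact: embK. Qed.

End ell1.

Section scalar_complete.
Variables (R : realType).

Lemma complex_complete (F : set_system (R[i])^o) :
  ProperFilter F -> cauchy F -> cvg F.
Proof.
move=> FF /cauchy_ballP Fc.
have normE (z : R[i]) : `|complex.Re z|%:C%C <= `|z| /\ `|complex.Im z|%:C%C <= `|z|.
  by case: z => a b /=; rewrite normc_def /= !lecR -!sqrtr_sqr !ler_wsqrtr//
    ?lerDl ?lerDr sqr_ge0.
have cauchyp (p : R[i] -> R) :
    (forall z w, `|p z - p w|%:C%C <= `|z - w|) -> cvg (p @ F).
  move=> pE; apply: cauchy_cvg; apply/cauchy_ballP => e e0.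
  have e0' : 0 < e%:C%C :> R[i] by rewrite ltcR.
  have [[A B] [FA FB] AB] := Fc _ e0'.
  exists (p @` A, p @` B) => /=.
    by split; [move: FA|move: FB]; apply: filterS => z ?; exists z.
  move=> [_ _] /= [[z Az <-] [w Bw <-]].
  have := AB (z, w) (conj Az Bw).
  rewrite -ball_normE /= => zw.
  by rewrite -ball_normE /= -ltcR (le_lt_trans (pE _ _)).
have /cvg_ex[a Fa] : cvg ((@complex.Re R) @ F).
  by apply: cauchyp => z w; rewrite (le_trans _ (normE _).1)//; case: z w => [? ?] [].
have /cvg_ex[b Fb] : cvg ((@complex.Im R) @ F).
  by apply: cauchyp => z w; rewrite (le_trans _ (normE _).2)//; case: z w => [? ?] [].
apply/cvg_ex; exists (a +i* b)%C; apply/cvgrPdist_lt => e e0.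
have eE : (complex.Re e)%:C%C = e.
  by case: e e0 => x y; rewrite ltcE /= => /andP[/eqP ->].
have e20 : 0 < complex.Re e / 2 by rewrite divr_gt0// -ltcR eE.
move/cvgrPdist_lt : Fa => /(_ _ e20) Fa.
move/cvgrPdist_lt : Fb => /(_ _ e20) Fb.
near=> z.
have /= az : `|a - complex.Re z| < complex.Re e / 2 by near: z.
have /= bz : `|b - complex.Im z| < complex.Re e / 2 by near: z.
rewrite -eE (_ : _ - z = (a - complex.Re z)%:C%C + 'i%C * (b - complex.Im z)%:C%C).
  rewrite (le_lt_trans (ler_normD _ _))// normrM.
  rewrite (_ : `|'i%C| = 1 :> R[i]) ?mul1r; last first.
    by rewrite normc_def /= expr0n expr1n add0r sqrtr1.
  rewrite !(normc_def _%:C%C) /= expr0n !addr0 !sqrtr_sqr -rmorphD ltcR.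
  by rewrite [ltRHS](splitr (complex.Re e)) ltrD.
by case: (z) => c d; rewrite [LHS]complexE; exact: erefl.
Unshelve. all: by end_near. Qed.

Lemma scalarField_complete (k : scalar_kind) (F : set_system (scalarField R k)^o) :
  ProperFilter F -> cauchy F -> cvg F.
Proof.
by case: k F => F; [exact: (@R_complete R)|exact: complex_complete].
Qed.

End scalar_complete.

Section ell1_complete.
Variables (R : realType) (k : scalar_kind).
Local Notation K := (scalarField R k).
Local Notation l1 := (ell1 R k).

Lemma ell1_le_norm (u : l1) N : \sum_(0 <= i < N) nrm (u i) <= nrm u.
Proof.
rewrite nrm_ell1E; apply: nondecreasing_cvgn_le; last exact: ell1_cvg.
by apply/nondecreasing_series => i _ _; exact: nrm_ge0.
Qed.

Lemma ell1_bounded (v : nat -> K^o) (M : R) :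
  (forall N, \sum_(0 <= i < N) nrm (v i) <= M) -> v \in @ell1_pred R k.
Proof.
move=> vM; apply/asboolP; apply: nondecreasing_is_cvgn.
  by apply/nondecreasing_series => i _ _; exact: nrm_ge0.
by exists M => _ [N _ <-]; exact: vM.
Qed.

Lemma ell1_norm_ub (u : l1) (M : R) :
  (forall N, \sum_(0 <= i < N) nrm (u i) <= M) -> nrm u <= M.
Proof.
move=> uM; rewrite nrm_ell1E; apply: limr_le; first exact: ell1_cvg.
by apply: nearW => N; exact: uM.
Qed.

Lemma ell1_complete (F : set_system l1) : ProperFilter F -> cauchy F -> cvg F.
Proof.
move=> FF /cauchy_ballP Fc.
have FcR (e : R) : 0 < e ->
    exists2 A, F A & forall u w, A u -> A w -> nrm (u - w) < e.
  move=> e0; have e0' : 0 < scalar_of_real k e by rewrite -(@emb0 R k) ltr_emb.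
  have [[A B] [FA FB] AB] := Fc _ e0'.
  exists (A `&` B) => [|u w [Au _] [_ Bw]]; first exact: filterI.
  have := AB (u, w) (conj Au Bw).
  by rewrite -ball_normE /= -emb_nrm ltr_emb.
have ev n : cvg ((fun u : l1 => u n) @ F).
  apply: scalarField_complete; apply/cauchy_ballP => e e0.
  have e0' : 0 < re e by rewrite -(@ltr_emb R k) emb0 emb_re// ltW.
  have [A FA AP] := FcR _ e0'.
  exists ((fun u : l1 => u n) @` A, (fun u : l1 => u n) @` A) => /=.
    by split; apply: (@filterS _ F _ A) => // u Au; exists u.
  move=> [_ _] /= [[u Au <-] [w Aw <-]].
  rewrite -ball_normE /= -[ltRHS]emb_re ?(ltW e0)// -emb_nrm ltr_emb.
  rewrite (le_lt_trans _ (AP _ _ Au Aw))// nrm_ell1E.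
  exact: (@ell1_norm_le R k (u - w)).
pose v n : K^o := lim ((fun u : l1 => u n) @ F).
have vF N (e : R) : 0 < e ->
    \forall u \near F, \sum_(0 <= i < N) nrm (v i - (u : l1) i) <= e.
  elim: N e => [|N IH] e e0.
    by apply: nearW => u; rewrite big_geq// ltW.
  have e20 : 0 < e / 2 by rewrite divr_gt0.
  have e20' : 0 < scalar_of_real k (e / 2) by rewrite -(@emb0 R k) ltr_emb.
  have /cvgrPdist_le /(_ _ e20') FN := ev N.
  have := IH _ e20; apply: filterS2 FN => u uN IHu.
  rewrite big_nat_recr//= [leRHS](splitr e) lerD//.
  by rewrite -(@ler_emb R k) emb_nrm.
have key (e : R) : 0 < e -> exists2 A, F A & forall u : l1, A u ->
    forall N, \sum_(0 <= i < N) nrm (v i - u i) <= e.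
  move=> e0; have e20 : 0 < e / 2 by rewrite divr_gt0.
  have [A FA AP] := FcR _ e20; exists A => // u Au N.
  have [w [Aw vw]] := @filter_ex _ F _ _ (@filterI _ F _ _ _ FA (vF N _ e20)).
  rewrite [leRHS](splitr e) (le_trans _ (lerD vw (ltW (AP _ _ Aw Au))))//.
  rewrite (le_trans _ (lerD (lexx _) (ell1_le_norm _ N)))// -big_split/=.
  apply: ler_sum => i _; rewrite (le_trans _ (ler_nrmD _ _))//.
  by rewrite addrA subrK.
have [A FA AP] := key _ ltr01.
have [u Au] := filter_ex FA.
pose d : l1 := Ell1 (ell1_bounded (AP u Au)).
pose V : l1 := d + u.
have VE i : V i = v i by rewrite [LHS]subrK.
apply/cvg_ex; exists V; apply/cvgrPdist_le => e e0.
have e0' : 0 < re e by rewrite -(@ltr_emb R k) emb0 emb_re// ltW.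
have [B FB BP] := key _ e0'.
apply: filterS FB => w Bw; rewrite -[leRHS]emb_re ?(ltW e0)// -emb_nrm ler_emb.
apply: ell1_norm_ub => N; apply: le_trans (BP w Bw N).
by apply: ler_sum => i _; rewrite -VE.
Qed.

HB.instance Definition _ := Uniform_isComplete.Build l1 ell1_complete.

End ell1_complete.

Section topologies.
Context {R : realType} {k : scalar_kind}.
Local Notation K := (scalarField R k).
Variable Z : normedModType K.

Definition weak : Type :=
  initial_topology (fun z : Z => (fun f : dual Z => f z) : {ptws dual Z -> K^o}).
HB.instance Definition _ := Topological.on weak.

Definition weak_star : Type :=
  initial_topology (fun f : dual Z => (f : Z -> K^o) : {ptws Z -> K^o}).
HB.instance Definition _ := Topological.on weak_star.

Definition weakly_compact (F : set Z) : Prop := compact (F : set weak).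

Definition weak_star_closure (A : set (dual Z)) : set (dual Z) :=
  closure (A : set weak_star).

Definition weakly_cauchy (z : nat -> Z) : Prop :=
  forall f : dual Z, cauchy ((fun n => f (z n)) @ \oo).

Definition weakly_null (z : nat -> Z) : Prop :=
  forall f : dual Z, (fun n => f (z n)) @ \oo --> (0 : K^o).

End topologies.

(* The suprema and infima below are taken in the extended reals.  They are
   over nonempty sets, except for the innermost one in oscillation when F is
   empty; that F then contributes -oo and is dominated by F = {0} in delta and
   in ca_rho. *)
Section quantities.
Context {R : realType} {k : scalar_kind}.
Local Notation K := (scalarField R k).

Definition tail_pairs (n : nat) : set (nat * nat) :=
  [set p | (n <= p.1)%N /\ (n <= p.2)%N].

Definition ca (Z : normedModType K) (z : nat -> Z) : \bar R :=
  ereal_inf (range (fun n =>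
    ereal_sup [set (nrm (z p.1 - z p.2))%:E | p in tail_pairs n])).

Definition cc (Z W : normedModType K) (S : blin Z W) : \bar R :=
  ereal_sup [set ca (S \o z) | z in
    [set z : nat -> Z | weakly_cauchy z /\ forall n, unit_ball (z n)]].

Section space.
Variable X : normedModType K.

Definition dist_to_space (phi : dual (dual X)) : \bar R :=
  ereal_inf (range (fun x : X => (nrm (phi - evaluation x))%:E)).

Definition wk (A : set X) : \bar R :=
  ereal_sup [set dist_to_space phi | phi in
    weak_star_closure (@evaluation R k X @` A)].

Definition wk_op (Y : normedModType K) (T : blin Y X) : \bar R :=
  wk (T @` @unit_ball R k Y).

Definition oscillation (F : set (dual X)) (x : nat -> X) : \bar R :=
  ereal_inf (range (fun n => ereal_sup [set
    ereal_sup [set (nrm (f (x p.1 - x p.2)))%:E | f in F]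
  | p in tail_pairs n])).

Definition delta (x : nat -> X) : \bar R :=
  ereal_sup [set oscillation F x | F in
    [set F : set (dual X) | finite_set F /\ F `<=` @unit_ball R k (dual X)]].

Definition ca_rho (x : nat -> X) : \bar R :=
  ereal_sup [set oscillation F x | F in
    [set F : set (dual X) |
      weakly_compact F /\ F `<=` @unit_ball R k (dual X)]].

Definition ca_rho_tilde (x : nat -> X) : \bar R :=
  ereal_inf [set ca_rho (x \o s) | s in
    [set s : nat -> nat | {homo s : i j / (i < j)%N}]].

End space.
End quantities.

(* Main.v *)
Require Import Defs.
From HB Require Import structures.
From mathcomp Require Import all_boot all_order all_algebra.
From mathcomp Require Import complex.
From mathcomp Require Import all_classical all_reals all_analysis.
From mathcomp Require Import ring lra.

Set Implicit Arguments.
Unset Strict Implicit.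
Unset Printing Implicit Defensive.

Import Order.TTheory GRing.Theory Num.Theory.
Import numFieldNormedType.Exports.

Local Open Scope classical_set_scope.
Local Open Scope ring_scope.

(** Throughout, weak-star cluster points of a bounded sequence are handled as
    limits along ultrafilters: for an ultrafilter U on the indices, the scalars
    f (x n) converge along U for every functional f, and their limits form an
    element of the bidual.  An element of the bidual is in the weak-star
    closure of a bounded set exactly when it arises in this way from a family
    in that set.

    The heart of the matter is [subseq_clusters_close]: if every cluster point
    of a bounded sequence x is within d of the space, then a subsequence of x
    has all its cluster points within 8 d of one another.  Indeed the closed
    linear span of x is separable, so countably many functionals of norm at
    most one compute the norm on it; a subsequence can be chosen along which
    all of them converge, hence they do not distinguish two cluster points phi
    and psi of that subsequence.  If y and z in the space are within d of phi
    and psi, then y - z is within 2 d of the span, because phi and psi both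
    vanish at the functionals that vanish on the span (Hahn-Banach), and the
    countably many functionals are at most 2 d on y - z; so y - z is small, and
    phi - psi too.

    This one lemma serves three times.

    - It takes the fourth assertion to the fifth at once, since delta is the
      diameter of the set of cluster points.

    - Applied to a sequence in a weakly compact subset of the dual, whose
      cluster points all lie in the space (d = 0), it yields a weakly
      convergent subsequence: the half of the Eberlein-Smulian theorem that is
      needed to get from the third assertion to the fourth.  There,
      functionals g_n from a weakly compact set on which x oscillates are
      replaced by h_n = (g_n - g) / 2 with g their weak limit, and the points
      by differences x_i - x_j, whose cluster points have norm at most
      delta x.

    - From the second assertion to the third it replaces a quantitative
      Krein theorem on the convex hull of x.  After passing to the subsequence
      and subtracting a point z near a cluster point, the sequence
      y_n = x_n - z has the property that each f in the dual ball satisfies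
      |f (y_n)| <= 10 d for large n.  The operator T a = sum a_n y_n on l1 then
      has weak non-compactness at most 20 d: if a converges coordinatewise to b
      along an ultrafilter, T a and T b differ asymptotically only through
      their tails.  Subtracting z costs nothing, because the functionals are
      weakly null.

    The remaining implication, from the fifth assertion to the first, tests T
    on points y_n of the unit ball where two late terms of a weakly Cauchy
    sequence of functionals are far apart; half the differences of the
    functionals, together with 0, form a weakly compact set, and being weakly
    null they are small on any fixed T y_m, so that a subsequence of T y_n can
    be nearly Cauchy uniformly on that set only if the functionals were not far
    apart. *)

(** * Norms with values in the reals *)

Section scalars.
Context {R : realType} {k : scalar_kind}.
Local Notation K := (scalarField R k).

Lemma nrmN (V : normedModType K) (x : V) : nrm (- x) = nrm x.
Proof. by rewrite /nrm normrN. Qed.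

Lemma nrmB (V : normedModType K) (x y : V) : nrm (x - y) = nrm (y - x).
Proof. by rewrite -nrmN opprB. Qed.

Lemma nrm_subD (V : normedModType K) (x y : V) : nrm x <= nrm (x - y) + nrm y.
Proof. by rewrite -{1}(subrK y x) ler_nrmD. Qed.

Lemma nrm_emb (r : R) : nrm (scalar_of_real k r : K^o) = `|r|.
Proof.
suff E : `|scalar_of_real k r| = scalar_of_real k `|r| :> K.
  by rewrite /nrm [X in re X]E embK.
have [r0|r0] := lerP 0 r.
  have e0 : 0 <= scalar_of_real k r by rewrite -(@emb0 R k) ler_emb.
  by rewrite [in RHS]ger0_norm// (ger0_norm e0).
have eN : scalar_of_real k (- r) = - scalar_of_real k r.
  by apply/eqP; rewrite -addr_eq0 -embD addNr emb0.
have e0 : 0 <= scalar_of_real k (- r).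
  by rewrite -(@emb0 R k) ler_emb oppr_ge0 ltW.
by rewrite -normrN -eN [in RHS]ltr0_norm// (ger0_norm e0).
Qed.

Lemma nrmM (a b : K^o) : nrm (a * b : K^o) = nrm a * nrm b.
Proof. exact: (nrmZ (a : K) b). Qed.

Lemma emb_gt0 (r : R) : (0 < scalar_of_real k r) = (0 < r).
Proof. by rewrite -(@emb0 R k) ltr_emb. Qed.

Lemma cvg_nrmP (V : normedModType K) (T : Type) (F : set_system T) (g : T -> V)
    (l : V) : Filter F ->
  g @ F --> l <-> forall e : R, 0 < e -> \forall t \near F, nrm (l - g t) < e.
Proof.
move=> FF; split=> [/cvgrPdist_lt gl e e0|gl].
  have e0' : 0 < scalar_of_real k e by rewrite emb_gt0.
  by apply: filterS (gl _ e0') => t; rewrite -emb_nrm ltr_emb.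
apply/cvgrPdist_lt => e e0.
have e0' : 0 < re e by rewrite -emb_gt0 emb_re// ltW.
apply: filterS (gl _ e0') => t lt.
by rewrite -emb_nrm -(emb_re (ltW e0)) ltr_emb.
Qed.

Lemma cvg_nrm (V : normedModType K) (T : Type) (F : set_system T) (g : T -> V)
    (l : V) : Filter F -> g @ F --> l -> (fun t => nrm (g t)) @ F --> nrm l.
Proof.
move=> FF /cvg_nrmP gl; apply/cvgrPdist_lt => e /gl; apply: filterS => t.
apply: le_lt_trans; rewrite ler_norml lerNl opprB !lerBlDr nrm_subD andbT.
by rewrite nrmB nrm_subD.
Qed.

Lemma nrm_cvg_le (V : normedModType K) (T : Type) (F : set_system T)
    (g : T -> V) (l : V) (M : R) : ProperFilter F -> g @ F --> l ->
  (\forall t \near F, nrm (g t) <= M) -> nrm l <= M.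
Proof.
move=> FF /cvg_nrmP gl gM; apply/ler_addgt0Pr => e /gl gle.
have [t [te tM]] := filter_ex (filterI gle gM).
by rewrite (le_trans (nrm_subD l (g t)))// addrC lerD// ltW.
Qed.

Lemma nrm_cvg_ge (V : normedModType K) (T : Type) (F : set_system T)
    (g : T -> V) (l : V) (M : R) : ProperFilter F -> g @ F --> l ->
  (\forall t \near F, M <= nrm (g t)) -> M <= nrm l.
Proof.
move=> FF /cvg_nrmP gl gM; apply/ler_addgt0Pr => e /gl gle.
have [t [te tM]] := filter_ex (filterI gle gM).
by rewrite (le_trans tM)// (le_trans (nrm_subD (g t) l))// addrC lerD// nrmB ltW.
Qed.

Lemma bounded_nrmP (V : normedModType K) (T : Type) (x : T -> V) :
  bounded_fun x <-> exists2 M : R, 0 <= M & forall t, nrm (x t) <= M.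
Proof.
split=> [/pinfty_ex_gt0[M M0 xM]|[M M0 xM]].
  exists (re M) => [|t]; first exact/re_ge0/ltW.
  by rewrite -(@ler_emb R k) emb_nrm emb_re ?(ltW M0)//; exact: xM.
exists (scalar_of_real k M); split.
  by rewrite realE -(@emb0 R k) !ler_emb M0.
move=> r Mr t _ /=; rewrite -emb_nrm (le_trans _ (ltW Mr))// ler_emb; exact: xM.
Qed.

End scalars.

Section complex_modulus.
Variable R : realType.
Local Notation C := (scalarField R ComplexScalars)^o.

Lemma complex_part_le_nrm (z : R[i]) :
  `|complex.Re z| <= nrm (z : C) /\ `|complex.Im z| <= nrm (z : C).
Proof.
have -> : nrm (z : C) = complex.Re (`|z| : R[i]) by [].
by case: z => a b; rewrite normc_def /= -!sqrtr_sqr !ler_wsqrtr//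
  ?lerDl ?lerDr sqr_ge0.
Qed.

Lemma nrm_complex_le (z : R[i]) :
  nrm (z : C) <= `|complex.Re z| + `|complex.Im z|.
Proof.
suff : `|z| <= (`|complex.Re z| + `|complex.Im z|)%:C%C :> R[i].
  have := @emb_nrm R ComplexScalars C z.
  by move=> <-; rewrite (@ler_emb R ComplexScalars).
rewrite {1}[z]complexE (le_trans (ler_normD _ _))// normrM.
rewrite (_ : `|'i%C| = 1 :> R[i]) ?mul1r; last first.
  by rewrite normc_def /= expr0n expr1n add0r sqrtr1.
by rewrite !(normc_def _%:C%C) /= expr0n !addr0 !sqrtr_sqr -rmorphD.
Qed.

End complex_modulus.

(** * Convergence in the weak and weak-star topologies *)

Lemma cvg_initialE (S : choiceType) (T : topologicalType) (h : S -> T)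
    (F : set_system S) (s : S) : Filter F ->
  F --> (s : initial_topology h) <-> h @ F --> h s.
Proof.
move=> FF; split=> [Fs|Fs].
  by move=> A /(@initial_continuous _ _ h s) /Fs.
move=> A /= [_ [[B oB <-] Bs] sBA].
by apply: filterS sBA _; apply: Fs; apply: open_nbhs_nbhs.
Qed.

(** Convergence for the weak and the weak-star topology is pointwise
    convergence; this and the preceding lemma unfold the initial topology of a
    map into a product, which is how both topologies are defined. *)
Lemma cvg_ptwsE (I : Type) (V : topologicalType) (F : set_system (I -> V))
    (s : I -> V) : Filter F ->
  F --> (s : {ptws I -> V}) <-> forall i, (fun g => g i) @ F --> s i.
Proof.
move=> FF; split=> [/cvg_sup Fs i|Fs].
  by have /cvg_initialE := Fs i.
by apply/cvg_sup => i; apply/cvg_initialE; exact: Fs.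
Qed.

Section weak_topologies.
Context {R : realType} {k : scalar_kind}.
Local Notation K := (scalarField R k).
Variable Z : normedModType K.

Lemma cvg_weakP (T : Type) (F : set_system T) (g : T -> Z) (z : Z) :
  Filter F ->
  (g : T -> weak Z) @ F --> (z : weak Z) <->
  forall f : dual Z, f (g t) @[t --> F] --> f z.
Proof.
move=> FF; split=> [/cvg_initialE/cvg_ptwsE //|gz].
by apply/cvg_initialE/cvg_ptwsE.
Qed.

Lemma cvg_weak_starP (T : Type) (F : set_system T) (g : T -> dual Z)
    (l : dual Z) : Filter F ->
  (g : T -> weak_star Z) @ F --> (l : weak_star Z) <->
  forall z : Z, g t z @[t --> F] --> l z.
Proof.
move=> FF; split=> [/cvg_initialE/cvg_ptwsE //|gz].
by apply/cvg_initialE/cvg_ptwsE.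
Qed.

End weak_topologies.

(** * Limits along ultrafilters and the bidual *)

Lemma fmap_ultra (T T' : Type) (h : T -> T') (U : set_system T) :
  UltraFilter U -> UltraFilter (h @ U).
Proof.
move=> UU; split=> [|G GG sUG]; first exact: fmap_proper_filter.
rewrite eqEsubset; split=> // A GA.
have [//|UnA] := in_ultra_setVsetC (h @^-1` A) UU.
have /filter_ex[? []//] : G (A `&` ~` A) by apply: filterI => //; exact: sUG.
Qed.

Lemma ultra_bounded_real_cvg (R : realType) (T : Type) (U : set_system T)
    (g : T -> R) (M : R) : UltraFilter U ->
  (\forall t \near U, `|g t| <= M) -> exists l : R, g @ U --> l.
Proof.
move=> UU gM.
have := @segment_compact R (- M) M; rewrite compact_ultra => /(_ (g @ U)).
case=> [|/=|l [_ gl]]; first exact: fmap_ultra.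
  by apply: filterS gM => t /=; rewrite in_itv /= -ler_norml.
by exists l.
Qed.

Section ultrafilter_limits.
Context {R : realType} {k : scalar_kind}.
Local Notation K := (scalarField R k).

Lemma ultra_bounded_cvg (T : Type) (U : set_system T) (g : T -> K^o) (M : R) :
  UltraFilter U -> (\forall t \near U, nrm (g t) <= M) -> exists l : K^o, g @ U --> l.
Proof.
move=> UU; case: k g => g gM; first exact: (@ultra_bounded_real_cvg R T U g M).
have [a /cvgrPdist_lt ga] : exists l : R, (fun t => complex.Re (g t)) @ U --> l.
  apply: (@ultra_bounded_real_cvg R T U _ M); apply: filterS gM => t.
  by apply: le_trans; rewrite (le_trans (complex_part_le_nrm _).1).
have [b /cvgrPdist_lt gb] : exists l : R, (fun t => complex.Im (g t)) @ U --> l.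
  apply: (@ultra_bounded_real_cvg R T U _ M); apply: filterS gM => t.
  by apply: le_trans; rewrite (le_trans (complex_part_le_nrm _).2).
exists (a +i* b)%C; apply/cvg_nrmP => e e0.
have e20 : 0 < e / 2 by rewrite divr_gt0.
near=> t.
have /= at_ : `|a - complex.Re (g t)| < e / 2 by near: t; exact: ga.
have /= bt : `|b - complex.Im (g t)| < e / 2 by near: t; exact: gb.
rewrite (le_lt_trans (nrm_complex_le _))// [ltRHS](splitr e).
by case: (g t) at_ bt => c d /= ? ?; rewrite ltrD.
Unshelve. all: by end_near. Qed.

Variable X : normedModType K.

(** This replaces weak-star compactness of balls of the bidual: the limits of
    all scalar families f (y t) along an ultrafilter exist by compactness of
    discs, and they depend linearly and boundedly on f. *)
Lemma ultra_bidual (T : Type) (U : set_system T) (y : T -> X) (M : R) :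
  UltraFilter U -> 0 <= M -> (forall t, nrm (y t) <= M) ->
  exists phi : dual (dual X), forall f : dual X, f (y t) @[t --> U] --> phi f.
Proof.
move=> UU M0 yM.
have /choice[phi phiE] : forall f : dual X, exists l : K^o, f (y t) @[t --> U] --> l.
  move=> f; apply: (@ultra_bounded_cvg T U _ (opnorm f * M)).
  apply: nearW => t.
  by rewrite (le_trans (ler_opnorm _ _))// ler_wpM2l// opnorm_ge0.
have phi_lin : linear phi.
  move=> a f g.
  have H : a *: f (y t) + g (y t) @[t --> U] --> a *: phi f + phi g.
    by apply: cvgD; [apply: cvgZl_tmp|]; exact: phiE.
  exact: (cvg_unique _ (phiE (a *: f + g)) H).
have phi_bd (f : dual X) : nrm (phi f) <= M * nrm f.
  apply: (@nrm_cvg_le R k K^o T U (fun t => f (y t)) _ _ _ (phiE f)).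
  apply: nearW => t.
  by rewrite nrm_blinE mulrC (le_trans (ler_opnorm _ _))// ler_wpM2l// opnorm_ge0.
by exists (Blin (blin_bound phi_lin phi_bd)).
Qed.

(** For the direct implication, the traces on D of the weak-star neighbourhoods
    of phi generate a proper filter on the indices; any ultrafilter refining it
    works. *)
Lemma weak_star_closureP (T : Type) (D : set T) (y : T -> X)
    (phi : dual (dual X)) :
  weak_star_closure (@evaluation R k X @` (y @` D)) phi <->
  exists U : set_system T, [/\ UltraFilter U, U D &
    forall f : dual X, f (y t) @[t --> U] --> phi f].
Proof.
split=> [clphi|[U [UU UD yU]]]; last first.
  have /cvg_weak_starP yphi : forall f : dual X,
    evaluation (y t) f @[t --> U] --> phi f by exact: yU.
  move=> B /yphi UB; have UB' : U ((fun t => evaluation (y t)) @^-1` B) by [].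
  have [t [Dt Bt]] := filter_ex (filterI UD UB').
  by exists (evaluation (y t)); split=> //; exists (y t) => //; exists t.
pose e : T -> weak_star (dual X) := fun t => evaluation (y t).
pose G : set_system T := filter_from (nbhs (phi : weak_star (dual X)))
  (fun B => D `&` e @^-1` B).
have GG : ProperFilter G.
  apply: filter_from_proper => [|B nB]; last first.
    by have [_ [[_ [t Dt <-] <-] Bt]] := clphi _ nB; exists t.
  apply: filter_from_filter => [|A B nA nB]; first by exists setT; exact: filterT.
  exists (A `&` B); first exact: filterI.
  by move=> t [Dt [At Bt]].
have [U [UU GU]] := ultraFilterLemma GG; exists U; split=> //.
  by apply: GU; exists setT; [exact: filterT|move=> t []].
apply/(@cvg_weak_starP _ _ _ T U e) => B nB; apply: GU; exists B => // t [].
Qed.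

End ultrafilter_limits.

(** * The Hahn-Banach theorem over the reals *)

Lemma le_infD (R : realType) (A B : set R) (c : R) :
  A !=set0 -> B !=set0 -> (forall a b, A a -> B b -> c <= a + b) ->
  c <= inf A + inf B.
Proof.
move=> A0 B0 cAB; rewrite -lerBlDr; apply: lb_le_inf => // a Aa.
rewrite lerBlDr addrC -lerBlDr; apply: lb_le_inf => // b Bb.
by rewrite lerBlDr addrC cAB.
Qed.

Section real_hahn_banach.
Variables (R : realType) (V : lmodType R).
Implicit Types (q : V -> R) (x y : V).

(** Positive homogeneity is stated as an inequality, which is easier to check;
    applying it to r and to the inverse of r gives equality, see [sublinearZ]. *)
Definition sublinear q :=
  (forall x y, q (x + y) <= q x + q y) /\
  (forall (r : R) x, 0 <= r -> q (r *: x) <= r * q x).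

Lemma sublinear0 q : sublinear q -> q 0 = 0.
Proof.
move=> [qD qZ]; apply/eqP; rewrite eq_le.
have := qZ 0 0 (lexx _); rewrite scale0r mul0r => -> /=.
by have := qD 0 0; rewrite addr0 -[X in X <= _]addr0 lerD2l.
Qed.

Lemma sublinear_opp q x : sublinear q -> - q (- x) <= q x.
Proof.
move=> sq; rewrite -subr_ge0 opprK -(sublinear0 sq) -(subrr x).
exact: sq.1.
Qed.

(** The tilt of q along y, the infimum of these values, is the largest
    sublinear functional below q that is additive in the direction y and keeps
    the value q y at y.  A minimal sublinear functional equals all its tilts,
    which makes it linear; and a linear functional below the tilt of p along w
    takes the value p w at w. *)
Definition tilt_set q y x : set R :=
  [set q (x + t *: y) - t * q y | t in [set t : R | 0 <= t]].

Definition tilt q y x : R := inf (tilt_set q y x).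

Lemma tilt_set_neq0 q y x : tilt_set q y x !=set0.
Proof. by exists (q (x + 0 *: y) - 0 * q y), 0 => /=. Qed.

Lemma sublinearZ q (r : R) x : sublinear q -> 0 <= r -> q (r *: x) = r * q x.
Proof.
move=> sq; rewrite le_eqVlt => /predU1P[<-|r0].
  by rewrite scale0r mul0r sublinear0.
apply/eqP; rewrite eq_le sq.2 ?(ltW r0)//= mulrC -ler_pdivlMr// mulrC.
rewrite -{1}(scalerK (lt0r_neq0 r0) x); apply: sq.2.
by rewrite invr_ge0 ltW.
Qed.

Lemma tilt_set_lb q y x : sublinear q -> lbound (tilt_set q y x) (- q (- x)).
Proof.
move=> sq _ [t t0 <-].
have := sq.1 (x + t *: y) (- x).
by rewrite addrAC subrr add0r sublinearZ//; lra.
Qed.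

Lemma tilt_le_at q y x (t : R) : sublinear q -> 0 <= t ->
  tilt q y x <= q (x + t *: y) - t * q y.
Proof.
move=> sq t0; apply: ge_inf; last by exists t.
by exists (- q (- x)); exact: tilt_set_lb.
Qed.

Lemma tilt_le q y x : sublinear q -> tilt q y x <= q x.
Proof.
move=> sq; have := @tilt_le_at q y x 0 sq (lexx _).
by rewrite scale0r addr0 mul0r subr0.
Qed.

Lemma tilt_le_shift q y x : sublinear q -> tilt q y x <= q (x + y) - q y.
Proof.
by move=> sq; have := @tilt_le_at q y x 1 sq ler01; rewrite scale1r mul1r.
Qed.

Lemma tilt_sublinear q y : sublinear q -> sublinear (tilt q y).
Proof.
move=> sq; split=> [x x'|r x].
  apply: le_infD; [exact: tilt_set_neq0|exact: tilt_set_neq0|].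
  move=> _ _ [t /= t0 <-] [s /= s0 <-].
  apply: (le_trans (tilt_le_at y (x + x') sq (addr_ge0 t0 s0))).
  rewrite scalerDl addrACA mulrDl.
  by have := sq.1 (x + t *: y) (x' + s *: y); lra.
rewrite le_eqVlt => /predU1P[<-|r0].
  by rewrite scale0r mul0r -(sublinear0 sq) tilt_le.
rewrite mulrC -ler_pdivrMr//; apply: lb_le_inf; first exact: tilt_set_neq0.
move=> _ [t /= t0 <-]; rewrite ler_pdivrMr//.
apply: (le_trans (tilt_le_at y (r *: x) sq (mulr_ge0 (ltW r0) t0))).
rewrite -scalerA -scalerDr sublinearZ ?(ltW r0)//.
by rewrite mulrBl; lra.
Qed.

(** Zorn's lemma applies because the pointwise infimum of a chain of sublinear
    functionals below p is finite, being at least - p (- x), and sublinear: for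
    two members of a chain, the smaller one serves for both summands. *)
Lemma minimal_sublinear p : sublinear p -> exists q, [/\ sublinear q,
  forall x, q x <= p x &
  forall q', sublinear q' -> (forall x, q' x <= q x) -> q' = q].
Proof.
move=> sp.
pose T := {q : V -> R | sublinear q /\ forall x, q x <= p x}.
pose below (q1 q2 : T) := `[< forall x, sval q2 x <= sval q1 x >].
have [||| |[q [sq qp]] qmin] := @Zorn T below.
- by move=> q; apply/asboolP.
- move=> q1 q2 q3 /asboolP q12 /asboolP q23; apply/asboolP => x.
  exact: le_trans (q23 x) (q12 x).
- move=> [q1 P1] [q2 P2] /asboolP /= q12 /asboolP /= q21; apply: eq_exist => /=.
  by apply/funext => x; apply/eqP; rewrite eq_le q21 q12.
- move=> A Atot.
  have [[q0 Aq0]|A0] := pselect (A !=set0); last first.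
    exists (exist _ p (conj sp (fun x => lexx (p x)))) => q Aq.
    by exfalso; apply: A0; exists q.
  pose vals x : set R := [set sval q x | q in A].
  have vals0 x : vals x !=set0 by exists (sval q0 x), q0.
  have valsl x (q : T) : A q -> inf (vals x) <= sval q x.
    move=> Aq; apply: ge_inf; last by exists q.
    exists (- p (- x)) => _ [r _ <-]; case: r => r [sr rp] /=.
    by apply: le_trans (sublinear_opp x sr); rewrite lerN2.
  have sinf : sublinear (fun x => inf (vals x)).
    split=> [x y|r x].
      apply: le_infD => // _ _ [q1 Aq1 <-] [q2 Aq2 <-].
      have [/asboolP q12|/asboolP q21] := Atot _ _ Aq1 Aq2.
        apply: (le_trans (valsl _ _ Aq2)).
        by rewrite (le_trans ((svalP q2).1.1 x y))// lerD.
      apply: (le_trans (valsl _ _ Aq1)).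
      by rewrite (le_trans ((svalP q1).1.1 x y))// lerD.
    rewrite le_eqVlt => /predU1P[<-|r0].
      rewrite scale0r mul0r (le_trans (valsl _ _ Aq0))//.
      by rewrite (sublinear0 (svalP q0).1).
    rewrite mulrC -ler_pdivrMr//; apply: lb_le_inf => // _ [q Aq <-].
    rewrite ler_pdivrMr// (le_trans (valsl _ _ Aq))// mulrC.
    by apply: (svalP q).1.2; exact: ltW.
  have infp x : inf (vals x) <= p x.
    by rewrite (le_trans (valsl _ _ Aq0))//; exact: (svalP q0).2.
  pose qinf : T := exist _ (fun x => inf (vals x)) (conj sinf infp).
  by exists qinf => q Aq; apply/asboolP => x; exact: valsl.
exists q; split=> // q' sq' q'q.
have q'p x : q' x <= p x by exact: le_trans (q'q x) (qp x).
pose t' : T := exist _ q' (conj sq' q'p).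
have /(congr1 sval) // : t' = exist _ q (conj sq qp).
by apply: qmin; apply/asboolP.
Qed.

(** A minimal sublinear functional q below the tilt of p along w satisfies q x
    <= q (x + y) - q y, since it equals its tilt along y.  So it is additive,
    and q (- w) <= - p w gives the equality at w. *)
Lemma sublinear_dominates_linear p w : sublinear p ->
  exists u : V -> R, [/\ linear (u : V -> R^o), forall x, u x <= p x & u w = p w].
Proof.
move=> sp; have [q [sq qp qmin]] := minimal_sublinear (tilt_sublinear w sp).
have qD x y : q (x + y) = q x + q y.
  apply/eqP; rewrite eq_le sq.1 /=.
  have tiltE : tilt q y = q.
    by apply: qmin; [exact: tilt_sublinear|move=> z; exact: tilt_le].
  by have := tilt_le_shift y x sq; rewrite tiltE lerBrDr.
have qN x : q (- x) = - q x.
  by apply/eqP; rewrite -addr_eq0 -qD addNr sublinear0.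
have qZ (r : R) x : q (r *: x) = r * q x.
  have [r0|r0] := lerP 0 r; first exact: sublinearZ.
  rewrite -[r in LHS]opprK scaleNr qN sublinearZ ?oppr_ge0 ?ltW//.
  by rewrite mulNr opprK.
exists q; split=> [r x y||].
- by rewrite qD qZ.
- by move=> x; apply: le_trans (qp x) (tilt_le _ _ sp).
- apply/eqP; rewrite eq_le (le_trans (qp w) (tilt_le _ _ sp)) /=.
  have := le_trans (qp (- w)) (tilt_le_shift w (- w) sp).
  by rewrite qN addNr sublinear0// sub0r lerN2.
Qed.

End real_hahn_banach.

(** * The Hahn-Banach theorem for seminorms over either scalar field *)

Section restriction_of_scalars.
Context {R : realType} {k : scalar_kind}.
Local Notation K := (scalarField R k).
Variable X : normedModType K.

(** The space X with scalars restricted to the reals; the alias keeps the real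
    module structure apart from the given one. *)
Definition realified : Type := X.
HB.instance Definition _ := GRing.Zmodule.on realified.

Definition real_scale (r : R) (x : realified) : realified :=
  scalar_of_real k r *: (x : X).

Lemma real_scaleA a b v : real_scale a (real_scale b v) = real_scale (a * b) v.
Proof. by rewrite /real_scale scalerA embM. Qed.

Lemma real_scale1 : left_id 1 real_scale.
Proof. by move=> v; rewrite /real_scale emb1 scale1r. Qed.

Lemma real_scaleDr : right_distributive real_scale +%R.
Proof. by move=> a u v; rewrite /real_scale scalerDr. Qed.

Lemma real_scaleDl v : {morph real_scale^~ v : a b / a + b}.
Proof. by move=> a b; rewrite /real_scale embD scalerDl. Qed.

HB.instance Definition _ := GRing.Zmodule_isLmodule.Build R realified
  real_scaleA real_scale1 real_scaleDr real_scaleDl.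

End restriction_of_scalars.

Section seminorm_hahn_banach.
Context {R : realType}.

Lemma re_le_nrm k (z : (scalarField R k)^o) : re z <= nrm z.
Proof.
case: k z => z; first exact: ler_norm.
by rewrite (le_trans (ler_norm _))// (complex_part_le_nrm _).1.
Qed.

(** In the complex case f x = u x - i u (i x), the only complex-linear
    functional with real part u. *)
Lemma complexify (k : scalar_kind) (X : normedModType (scalarField R k))
    (u : realified X -> R^o) : linear u ->
  exists f : X -> (scalarField R k)^o, linear f /\ forall x, re (f x) = u x.
Proof.
case: k X u => X u ul.
  exists u; split=> // a x y; exact: ul.
have uD x y : u (x + y) = u x + u y.
  by have := ul 1 x y; rewrite !scale1r.
have uZ (r : R) (x : X) : u (r%:C%C *: x) = r * u x.
  have u0 : u 0 = 0 by apply/(addIr (u 0)); rewrite -uD !add0r.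
  by have := ul r x 0; rewrite !addr0 u0 addr0.
exists (fun x : X => (u x +i* - u ('i%C *: x))%C); split=> // -[r s] x y /=.
have aE (z : X) : (r +i* s)%C *: z = r%:C%C *: z + s%:C%C *: ('i%C *: z).
  rewrite scalerA -scalerDl; congr (_ *: _); apply/eqP.
  by rewrite eq_complex /= !(mulr0, mul0r, mulr1, subr0, addr0, add0r) !eqxx.
have iiE (z : X) : 'i%C *: ('i%C *: z) = (-1)%:C%C *: z.
  rewrite scalerA; congr (_ *: _); apply/eqP.
  by rewrite eq_complex /= !(mulr0, mul0r, mulr1, subr0, addr0, add0r, sub0r) !eqxx.
have iaE (z : X) : 'i%C *: ((r +i* s)%C *: z) =
    r%:C%C *: ('i%C *: z) + s%:C%C *: ((-1)%:C%C *: z).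
  rewrite -iiE !scalerA -scalerDl; congr (_ *: _).
  apply/eqP; rewrite eq_complex /=.
  rewrite !(mulr0, mul0r, mulr1, mul1r, subr0, addr0, add0r, sub0r).
  by rewrite oppr0 sub0r !eqxx.
have mulE (a b c d : R) : (r +i* s)%C *:
    ((a +i* b)%C : (scalarField R ComplexScalars)^o) + (c +i* d)%C =
    ((r * a - s * b + c) +i* (r * b + s * a + d))%C by [].
rewrite mulE scalerDr iaE aE !uD !uZ.
by congr (_ +i* _)%C; ring.
Qed.

Variable k : scalar_kind.
Local Notation K := (scalarField R k).
Variable X : normedModType K.

(** The bound on the real part of f extends to its modulus because p is
    invariant under multiplication by scalars of modulus one: rotate x so that
    f x becomes real and nonnegative. *)
Lemma seminorm_dominates_functional (p : X -> R) (w : X) :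
  (forall x y, p (x + y) <= p x + p y) ->
  (forall (a : K) x, p (a *: x) = nrm (a : K^o) * p x) ->
  (forall x, p x <= nrm x) ->
  exists f : dual X, (forall x, nrm (f x) <= p x) /\ nrm (f w) = p w.
Proof.
move=> pD pZ pn.
have sp : sublinear (p : realified X -> R).
  by split=> [|r x r0]; [exact: pD|rewrite pZ nrm_emb ger0_norm].
have [u [ul up uw]] := sublinear_dominates_linear (w : realified X) sp.
have [f [fl fu]] := complexify ul.
have fp x : nrm (f x) <= p x.
  have [fx0|fx0] := eqVneq (f x) 0.
    have := pZ 0 x; rewrite scale0r nrm0 mul0r => p0.
    have := pD x (- x); rewrite subrr p0 -scaleN1r pZ.
    have -> : nrm (-1 : K^o) = 1 by rewrite nrmN /nrm normr1 re1.
    by rewrite mul1r fx0 nrm0; lra.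
  pose th : K := `|f x| / f x.
  have nth : nrm (th : K^o) = 1.
    by rewrite /nrm normf_div normr_id divff ?re1// normr_eq0.
  have := up (th *: x); rewrite -fu.
  have -> : f (th *: x) = th * f x.
    have f0 : f 0 = 0.
      by have := fl 1 0 0; rewrite !scale1r addr0 => /esym/eqP;
        rewrite -[X in _ == X]addr0 (inj_eq (addrI _)) => /eqP.
    by have := fl th x 0; rewrite !addr0 f0 addr0.
  by rewrite divfK// pZ nth mul1r.
have fn x : nrm (f x) <= 1 * nrm x by rewrite mul1r (le_trans (fp x)).
exists (Blin (blin_bound fl fn)); split=> //=.
apply/eqP; rewrite eq_le fp /= -uw -fu.
exact: re_le_nrm.
Qed.
End seminorm_hahn_banach.

(** * Separability of the span of a sequence *)

Section functionals.
Context {R : realType} {k : scalar_kind}.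
Local Notation K := (scalarField R k).

Lemma blinBE (X Y : normedModType K) (f g : blin X Y) x : (f - g) x = f x - g x.
Proof. by []. Qed.

Lemma blin_le_nrm (X Y : normedModType K) (f : blin X Y) x :
  nrm (f x) <= nrm f * nrm x.
Proof. by rewrite nrm_blinE ler_opnorm. Qed.

Lemma blin_nrm_le (X Y : normedModType K) (f : blin X Y) (M : R) :
  (forall x, nrm x <= 1 -> nrm (f x) <= M) -> nrm f <= M.
Proof.
move=> fM; rewrite nrm_blinE; apply: opnorm_le => x.
by rewrite -nrm_le1; exact: fM.
Qed.

Lemma nrm_evaluation_le (X : normedModType K) (x : X) : nrm (evaluation x) <= nrm x.
Proof.
apply: blin_nrm_le => f f1; rewrite (le_trans (blin_le_nrm f x))//.
by rewrite ler_piMl// nrm_ge0.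
Qed.

Variable X : normedModType K.

Lemma norming_functional (w : X) :
  exists f : dual X, nrm f <= 1 /\ nrm (f w) = nrm w.
Proof.
have [f [f1 fw]] := @seminorm_dominates_functional R k X (@nrm R k X) w
  (@ler_nrmD R k X) (@nrmZ R k X) (fun x => lexx _).
exists f; split=> //; apply: blin_nrm_le => x x1.
exact: le_trans (f1 x) x1.
Qed.

(** Finite linear combinations built one term at a time, so that membership can
    be used by induction. *)
Inductive lin_span (A : set X) : X -> Prop :=
| lin_span0 : lin_span A 0
| lin_span_cons (a : K) x s : A x -> lin_span A s -> lin_span A (a *: x + s).

Lemma lin_spanD (A : set X) s t :
  lin_span A s -> lin_span A t -> lin_span A (s + t).
Proof.
by elim=> [|a x s' Ax _ IH] At; rewrite ?add0r// -addrA; apply: lin_span_cons;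
  last exact: IH.
Qed.

Lemma lin_spanZ (A : set X) (a : K) s : lin_span A s -> lin_span A (a *: s).
Proof.
elim=> [|b x s' Ax _ IH]; first by rewrite scaler0; exact: lin_span0.
by rewrite scalerDr scalerA; exact: lin_span_cons.
Qed.

Lemma lin_span_mem (A : set X) x : A x -> lin_span A x.
Proof.
move=> Ax; rewrite -[x]addr0 -[x]scale1r; apply: lin_span_cons => //.
exact: lin_span0.
Qed.

(** The distance to the span is a seminorm below the norm; a functional that it
    dominates vanishes on the span, and one of them takes at w the value of the
    distance. *)
Lemma lin_span_approx (A : set X) (w : X) (d : R) :
  (forall f : dual X, nrm f <= 1 -> (forall x, A x -> f x = 0) ->
    nrm (f w) <= d) ->
  forall e : R, 0 < e -> exists2 s, lin_span A s & nrm (w - s) < d + e.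
Proof.
move=> fd e e0.
pose dists v : set R := [set nrm (v - s) | s in lin_span A].
pose p v := inf (dists v).
have dists0 v : dists v !=set0 by exists (nrm (v - 0)), 0 => //; exact: lin_span0.
have distl v : has_lbound (dists v) by exists 0 => _ [s _ <-]; exact: nrm_ge0.
have ple v s : lin_span A s -> p v <= nrm (v - s).
  by move=> As; apply: ge_inf => //; exists s.
have pD x y : p (x + y) <= p x + p y.
  apply: le_infD => // _ _ [s As <-] [t At <-].
  apply: (le_trans (ple _ _ (lin_spanD As At))).
  by rewrite opprD addrACA ler_nrmD.
have pn x : p x <= nrm x by rewrite -{2}(subr0 x); apply: ple; exact: lin_span0.
have p_ge0 x : 0 <= p x by apply: lb_le_inf => // _ [s _ <-]; exact: nrm_ge0.
have pZle (a : K) x : a != 0 -> p (a *: x) <= nrm (a : K^o) * p x.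
  move=> a0; have na0 : 0 < nrm (a : K^o).
    rewrite lt_neqAle nrm_ge0 andbT eq_sym; apply: contra_neq a0.
    exact: (@nrm0_eq0 R k K^o a).
  rewrite mulrC -ler_pdivrMr//; apply: lb_le_inf => // _ [s As <-].
  rewrite ler_pdivrMr// mulrC -nrmZ scalerBr.
  by apply: ple; exact: lin_spanZ.
have pZ (a : K) x : p (a *: x) = nrm (a : K^o) * p x.
  have [->|a0] := eqVneq a 0.
    rewrite scale0r nrm0 mul0r; apply/eqP; rewrite eq_le p_ge0 andbT.
    by rewrite (le_trans (pn _))// nrm0.
  apply/eqP; rewrite eq_le pZle//=.
  have ai0 : a^-1 != 0 by rewrite invr_eq0.
  have aa : nrm (a : K^o) * nrm (a^-1 : K^o) = 1.
    by rewrite -nrmM divff// /nrm normr1 re1.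
  have := pZle a^-1 (a *: x) ai0; rewrite scalerA mulVf// scale1r.
  move=> /(ler_wpM2l (nrm_ge0 (a : K^o))).
  by rewrite mulrA aa mul1r.
have [f [fp fw]] := seminorm_dominates_functional w pD pZ pn.
have pwd : p w <= d.
  rewrite -fw; apply: fd => [|x Ax].
    apply: blin_nrm_le => x x1; apply: le_trans x1.
    exact: le_trans (fp x) (pn x).
  apply: nrm0_eq0; apply/eqP; rewrite eq_le nrm_ge0 andbT (le_trans (fp x))//.
  by rewrite (le_trans (ple x x _))// ?subrr ?nrm0//; exact: lin_span_mem.
have [_ [s As <-] se] := inf_adherent e0 (conj (dists0 w) (distl w)).
by exists s => //; rewrite (lt_le_trans se)// lerD2r.
Qed.

End functionals.

Section countable_span.
Context {R : realType} {k : scalar_kind}.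
Local Notation K := (scalarField R k).

(** A countable dense set of scalars, with one index type for both fields. *)
Definition rational_scalar (q : rat * rat) : K :=
  match k as k0 return scalarField R k0 with
  | RealScalars => ratr q.1
  | ComplexScalars => (ratr q.1 +i* ratr q.2)%C
  end.

Lemma rational_scalar_dense (a : K) (e : R) : 0 < e ->
  exists q, nrm (a - rational_scalar q : K^o) < e.
Proof.
have dense (b d : R) : 0 < d -> exists q : rat, `|b - ratr q| < d.
  move=> d0; have [q] := @rat_in_itvoo R (b - d) (b + d) ltac:(lra).
  rewrite in_itv /= => /andP[q1 q2].
  by exists q; rewrite ltr_norml; apply/andP; split; lra.
rewrite /rational_scalar; case: k a => a e0.
  by have [q qe] := dense a e e0; exists (q, 0); exact: qe.
have e20 : 0 < e / 2 by rewrite divr_gt0.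
have [q1 qe1] := dense (complex.Re a) _ e20.
have [q2 qe2] := dense (complex.Im a) _ e20.
exists (q1, q2) => /=.
rewrite (le_lt_trans (nrm_complex_le _))// [ltRHS](splitr e).
by case: a qe1 qe2 => a b /= ? ?; rewrite ltrD.
Qed.

Variables (X : normedModType K) (x : nat -> X).

Definition rational_combination (c : seq (nat * (rat * rat))) : X :=
  foldr (fun t s => rational_scalar t.2 *: x t.1 + s) 0 c.

Lemma lin_span_rational s (e : R) : lin_span (range x) s -> 0 < e ->
  exists c, nrm (s - rational_combination c) < e.
Proof.
move=> sx; elim: sx e => [|a _ s' [n _ <-] _ IH] e e0.
  by exists [::]; rewrite /= subrr nrm0.
have e20 : 0 < e / 2 by rewrite divr_gt0.
have [c sc] := IH _ e20.
have xn0 : 0 < nrm (x n) + 1 by rewrite ltr_wpDl ?nrm_ge0.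
have e1 : 0 < e / 2 / (nrm (x n) + 1) by rewrite divr_gt0.
have [q aq] := rational_scalar_dense a e1.
exists ((n, q) :: c) => /=.
rewrite opprD addrACA -scalerBl (le_lt_trans (ler_nrmD _ _))//.
rewrite [ltRHS](splitr e) ler_ltD// nrmZ.
rewrite (le_trans (ler_wpM2r (nrm_ge0 _) (ltW aq)))//.
by rewrite mulrAC ler_pdivrMr// ler_wpM2l ?(ltW e20)// lerDl.
Qed.

End countable_span.

(** * A subsequence whose cluster points are close together *)

(** Each choice is made beyond the previous one, which is why the hypothesis
    asks for witnesses arbitrarily far out. *)
Lemma extraction (P : nat -> nat -> Prop) :
  (forall n N, exists2 m, (N <= m)%N & P n m) ->
  exists2 s : nat -> nat, {homo s : i j / (i < j)%N} & forall n, P n (s n).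
Proof.
move=> PP.
have /choice[h hP] : forall t : nat * nat,
    exists m, (t.2 <= m)%N /\ P t.1 m.
  by move=> [n N]; have [m ? ?] := PP n N; exists m.
pose s := fix s n := if n is n'.+1 then h (n, (s n').+1) else h (0, 0)%N.
exists s; last by case=> [|n]; exact: (hP (_, _)).2.
apply: (homo_ltn ltn_trans) => n; exact: (hP (n.+1, (s n).+1)).1.
Qed.

Lemma leq_homo_id (s : nat -> nat) n :
  {homo s : i j / (i < j)%N} -> (n <= s n)%N.
Proof.
move=> sh; elim: n => // n IH; exact: leq_ltn_trans IH (sh _ _ (ltnSn n)).
Qed.

Lemma cofinal_fmap (i : nat -> nat) (U : set_system nat) : Filter U ->
  \oo `<=` U -> (forall n, (n <= i n)%N) -> \oo `<=` i @ U.
Proof.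
move=> UU oU ni A [N _ NA]; apply: oU; exists N => // n Nn.
exact/NA/(leq_trans Nn).
Qed.

(** Ultrafilters on the naturals that contain all cofinite sets produce the
    cluster points of a sequence. *)
Lemma free_ultrafilter :
  exists U : set_system nat, UltraFilter U /\ \oo `<=` U.
Proof. exact: ultraFilterLemma. Qed.

Section clusters.
Context {R : realType} {k : scalar_kind}.
Local Notation K := (scalarField R k).
Variable X : normedModType K.

Definition weak_star_cluster (x : nat -> X) (phi : dual (dual X)) :=
  exists U : set_system nat, [/\ UltraFilter U, \oo `<=` U &
    forall f : dual X, f (x n) @[n --> U] --> phi f].

(** The indices i n >= n need not be increasing, so that cluster points of
    families extracted by a choice function are covered too. *)
Lemma cluster_along (x : nat -> X) (i : nat -> nat) (U : set_system nat)
    (phi : dual (dual X)) : UltraFilter U -> \oo `<=` U ->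
  (forall n, (n <= i n)%N) ->
  (forall f : dual X, f (x (i n)) @[n --> U] --> phi f) ->
  weak_star_cluster x phi.
Proof.
move=> UU oU ni xphi; exists (i @ U); split=> //; first exact: fmap_ultra.
exact: cofinal_fmap.
Qed.

Lemma cluster_subseq (x : nat -> X) (s : nat -> nat) (phi : dual (dual X)) :
  {homo s : i j / (i < j)%N} ->
  weak_star_cluster (x \o s) phi -> weak_star_cluster x phi.
Proof.
move=> sh [U [UU oU xphi]]; apply: (@cluster_along x s U) => // n.
exact: leq_homo_id.
Qed.

Lemma cluster_closure (x : nat -> X) (phi : dual (dual X)) :
  weak_star_cluster x phi ->
  weak_star_closure (@evaluation R k X @` range x) phi.
Proof.
move=> [U [UU _ xphi]]; apply/weak_star_closureP.
by exists U; split=> //; exact: filterT.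
Qed.

Lemma cluster_exists (x : nat -> X) (M : R) :
  0 <= M -> (forall n, nrm (x n) <= M) -> exists phi, weak_star_cluster x phi.
Proof.
move=> M0 xM; have [U [UU oU]] := free_ultrafilter.
have [phi xphi] := ultra_bidual UU M0 xM.
by exists phi, U.
Qed.

Lemma cluster_near_cvg (x : nat -> X) (f : dual X) (l : K^o)
    (phi : dual (dual X)) :
  f (x n) @[n --> \oo] --> l -> weak_star_cluster x phi -> phi f = l.
Proof.
move=> fl [U [UU oU xphi]].
have flU : f (x n) @[n --> U] --> l by move=> A lA; exact: oU (fl A lA).
exact: (cvg_unique _ (xphi f) flU).
Qed.

(** The closed linear span of x is separable, so countably many functionals g c
    of norm at most one are norming on it.  A single free ultrafilter provides
    the limits phi0 (g c), and the n-th term of the subsequence is chosen close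
    to these limits for the first n + 1 of the g c, which avoids a diagonal
    argument.  Two cluster points of the subsequence then agree on every g c
    and on every functional vanishing on the span.  If y and z are points of X
    close to them, y - z lies near the span by the second fact and is small by
    the first.  The constant comes from 2 d for the distance of y - z to a
    point w of the span, 4 d for the norm of w, and d for each passage from the
    cluster points to y and z. *)
Lemma subseq_clusters_close (x : nat -> X) (M d : R) :
  0 <= M -> (forall n, nrm (x n) <= M) ->
  (forall phi, weak_star_cluster x phi ->
    exists z : X, nrm (phi - evaluation z) <= d) ->
  exists2 s : nat -> nat, {homo s : i j / (i < j)%N} &
    forall phi psi, weak_star_cluster (x \o s) phi ->
      weak_star_cluster (x \o s) psi -> nrm (phi - psi) <= 8 * d.
Proof.
move=> M0 xM xd.
have [U [UU oU]] := free_ultrafilter.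
have [phi0 xphi0] := ultra_bidual UU M0 xM.
have /choice[g gP] : forall c, exists f : dual X, nrm f <= 1 /\
    nrm (f (rational_combination x c)) = nrm (rational_combination x c).
  by move=> c; exact: norming_functional.
(* The index m is good at stage n when the first n + 1 norming functionals are
   already close at x m to their limits along U. *)
pose close n m := forall c, (pickle c <= n)%N ->
  nrm (phi0 (g c) - g c (x m)) < n.+1%:R^-1.
have closeU n : U (close n).
  have U1 j : U [set m | forall c, pickle c = j ->
      nrm (phi0 (g c) - g c (x m)) < n.+1%:R^-1].
    have [[c cj]|nc] := pselect (exists c : seq (nat * (rat * rat)), pickle c = j).
      have := xphi0 (g c) => /cvg_nrmP/(_ n.+1%:R^-1 ltac:(by rewrite invr_gt0)).
      apply: filterS => m /= xm c' c'j.
      by rewrite (pcan_inj pickleK (etrans c'j (esym cj))).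
    by apply: filterE => m c cj; exfalso; apply: nc; exists c.
  suff UJ J : U [set m | forall c, (pickle c < J)%N ->
      nrm (phi0 (g c) - g c (x m)) < n.+1%:R^-1] by exact: UJ n.+1.
  elim: J => [|J IH]; first exact: filterE.
  apply: filterS2 IH (U1 J) => m lt_m eq_m c.
  by rewrite ltnS leq_eqVlt => /predU1P[/eq_m|/lt_m].
have [s sh sP] : exists2 s : nat -> nat, {homo s : i j / (i < j)%N} &
    forall n, close n (s n).
  apply: extraction => n N.
  have UN : U [set m | (N <= m)%N] by apply: oU; exists N.
  by have [m [? ?]] := filter_ex (filterI UN (closeU n)); exists m.
exists s => // phi psi cphi cpsi.
have gs c : g c ((x \o s) n) @[n --> \oo] --> phi0 (g c).
  apply/cvg_nrmP => e e0; near=> n.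
  have cn : (pickle c <= n)%N by near: n; exact: nbhs_infty_ge.
  rewrite (lt_trans (sP n c cn))//.
  rewrite invf_plt ?posrE// -natr1 ltr_wpDr//.
  by near: n; exact: nbhs_infty_gtr.
have gE c : phi (g c) = psi (g c).
  by rewrite (cluster_near_cvg (gs c) cphi) (cluster_near_cvg (gs c) cpsi).
(* Cluster points agree on functionals that vanish on the span, which gives the
   distance of y - z to the span by Hahn-Banach below. *)
have span0 (f : dual X) : (forall y, range x y -> f y = 0) -> phi f = 0 /\ psi f = 0.
  move=> f0; have fx : f ((x \o s) n) @[n --> \oo] --> (0 : K^o).
    have -> : (fun n => f ((x \o s) n)) = cst 0.
      by apply/funext => n; apply: f0; exists (s n).
    exact: cvg_cst.
  by rewrite (cluster_near_cvg fx cphi) (cluster_near_cvg fx cpsi).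
have [y yphi] := xd _ (cluster_subseq sh cphi).
have [z zpsi] := xd _ (cluster_subseq sh cpsi).
(* A functional that does not distinguish phi from psi sees y - z only through
   the two approximation errors. *)
have diff (f : dual X) : nrm f <= 1 -> phi f = psi f -> nrm (f (y - z)) <= d + d.
  move=> f1 fE; have -> : f (y - z) = (psi - evaluation z) f - (phi - evaluation y) f.
    by rewrite !blinBE /= linearB fE opprB addrACA [- f z + _]addrC addrACA subrr add0r.
  rewrite (le_trans (ler_nrmD _ _))// nrmN lerD//.
    by rewrite (le_trans (blin_le_nrm _ _))// (le_trans (ler_piMr _ f1))// nrm_ge0.
  by rewrite (le_trans (blin_le_nrm _ _))// (le_trans (ler_piMr _ f1))// nrm_ge0.
apply/ler_addgt0Pr => e e0.
have e40 : 0 < e / 4 by rewrite divr_gt0.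
have [v xv yzv] : exists2 v, lin_span (range x) v & nrm (y - z - v) < d + d + e / 4.
  apply: lin_span_approx => // f f1 f0; apply: diff => //.
  by have [-> ->] := span0 f f0.
have [c vc] := lin_span_rational xv e40.
set w := rational_combination x c in vc.
have yzw : nrm (y - z - w) < d + d + e / 2.
  rewrite (le_lt_trans (nrm_subD _ (v - w)))//.
  rewrite opprB addrA subrK.
  by have := ltrD yzv vc; lra.
have [gc1 gcw] := gP c.
have nw : nrm w <= (d + d) + nrm (y - z - w).
  rewrite -gcw -/w.
  have -> : g c w = g c (y - z) - g c (y - z - w) by rewrite -linearB opprB addrC subrK.
  rewrite (le_trans (ler_nrmD _ _))// nrmN lerD//; first exact: diff.
  by rewrite (le_trans (blin_le_nrm _ _))// ler_piMl// nrm_ge0.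
have nyz : nrm (y - z) <= nrm (y - z - w) + nrm w by exact: nrm_subD.
have -> : phi - psi = (phi - evaluation y) - (psi - evaluation z) + evaluation (y - z).
  apply/val_inj/funext => f.
  change (phi f - psi f = (phi f - f y) - (psi f - f z) + f (y - z)).
  by rewrite (linearB f y z) [RHS]addrAC addrA subrK opprB addrA subrK.
rewrite (le_trans (ler_nrmD _ _))//.
have := ler_nrmD (phi - evaluation y) (- (psi - evaluation z)).
have := nrm_evaluation_le (y - z).
rewrite nrmN; lra.
Unshelve. all: by end_near. Qed.

End clusters.

(** * The quantities of weak non-compactness *)

Section extended_reals.
Variable R : realType.
Local Open Scope ereal_scope.

Lemma lee_from_below (L : \bar R) (b : R) :
  (forall c : R, c%:E < L -> (c <= b)%R) -> L <= b%:E.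
Proof.
move=> cL; rewrite leNgt; apply/negP; case: L cL => [l| |//] cL bl.
  have := cL ((l + b) / 2)%R; rewrite !lte_fin in bl *; lra.
by have := cL (b + 1)%R (ltry _); lra.
Qed.

(** Turns an inequality between extended reals into one about real numbers
    strictly below L and strictly above W, for which suprema and infima provide
    witnesses without any attainment or finiteness question. *)
Lemma lee_mul_between (L W : \bar R) (C : R) : (0 < C)%R ->
  (forall c d : R, c%:E < L -> W < d%:E -> (c <= C * d)%R) ->
  L <= C%:E * W.
Proof.
move=> C0 cd.
have CK d : (C * (d / C) = d)%R by rewrite mulrC divfK// gt_eqF.
case: W cd => [w| |] cd.
- apply: lee_from_below => c cL; apply/ler_addgt0Pr => e e0.
  have := cd c (w + e / C)%R cL.
  rewrite lte_fin ltrDl divr_gt0// => /(_ isT).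
  by rewrite mulrDr CK.
- by rewrite gt0_muley ?lte_fin// leey.
- rewrite gt0_muleNy ?lte_fin// leeNy_eq; case: L cd => [l| |//] cd.
    have := cd (l - 1)%R ((l - 2) / C)%R; rewrite CK.
    by rewrite lte_fin ltrBlDr ltrDl ltr01 ltNyr => /(_ isT isT); lra.
  have := cd 0%R (- 1 / C)%R (ltry _) (ltNyr _).
  by rewrite CK; lra.
Qed.

End extended_reals.

Section quantities_in_reals.
Context {R : realType} {k : scalar_kind}.
Local Notation K := (scalarField R k).
Variable X : normedModType K.

Lemma wk_ltP (A : set X) (d : R) phi : (wk A < d%:E)%E ->
  weak_star_closure (@evaluation R k X @` A) phi ->
  exists z : X, nrm (phi - evaluation z) < d.
Proof.
move=> wd Aphi.
have /ereal_inf_lt[_ [z _ <-]] : (dist_to_space phi < d%:E)%E.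
  by apply: le_lt_trans wd; apply: ereal_sup_ubound; exists phi.
by rewrite lte_fin => zd; exists z.
Qed.

Lemma wk_le (A : set X) (d : R) :
  (forall phi, weak_star_closure (@evaluation R k X @` A) phi ->
    exists z : X, nrm (phi - evaluation z) <= d) -> (wk A <= d%:E)%E.
Proof.
move=> Ad; apply: ge_ereal_sup => _ [phi Aphi <-].
have [z zd] := Ad _ Aphi; apply: ge_ereal_inf.
by exists (nrm (phi - evaluation z))%:E; [exists z|rewrite lee_fin].
Qed.

Lemma wk_mono (A B : set X) : A `<=` B -> (wk A <= wk B)%E.
Proof.
move=> AB; apply: ereal_sup_le => _ [phi Aphi <-]; exists phi => //.
by apply: closureS Aphi; exact: image_subset.
Qed.

Lemma oscillation_le (F : set (dual X)) (x : nat -> X) (D : R) :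
  (exists N, forall i j f, (N <= i)%N -> (N <= j)%N -> F f ->
    nrm (f (x i - x j)) <= D) -> (oscillation F x <= D%:E)%E.
Proof.
move=> [N ND]; apply: ge_ereal_inf; eexists; first by exists N.
apply: ge_ereal_sup => _ [[i j] [/= Ni Nj] <-].
by apply: ge_ereal_sup => _ [f Ff <-]; rewrite lee_fin; exact: ND.
Qed.

Lemma oscillation_lt (F : set (dual X)) (x : nat -> X) (D : R) :
  (oscillation F x < D%:E)%E ->
  exists N, forall i j f, (N <= i)%N -> (N <= j)%N -> F f ->
    nrm (f (x i - x j)) < D.
Proof.
move=> /ereal_inf_lt[_ [N _ <-] ND]; exists N => i j f Ni Nj Ff.
rewrite -lte_fin; apply: le_lt_trans ND; apply: le_ereal_sup_tmp.
eexists; first by exists (i, j).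
by apply: ereal_sup_ubound; exists f.
Qed.

Lemma oscillation_gt (F : set (dual X)) (x : nat -> X) (c : R) :
  (c%:E < oscillation F x)%E ->
  forall N, exists i j f, [/\ (N <= i)%N, (N <= j)%N, F f &
    c < nrm (f (x i - x j))].
Proof.
move=> cF N.
have /ereal_sup_gt[_ [[i j] [/= Ni Nj] <-]] : (c%:E < ereal_sup [set
    ereal_sup [set (nrm (f (x p.1 - x p.2)))%:E | f in F]
  | p in tail_pairs N])%E.
  by apply: (lt_le_trans cF); apply: ereal_inf_lbound; exists N.
move=> /ereal_sup_gt[_ [f Ff <-]]; rewrite lte_fin => cf.
by exists i, j, f.
Qed.

Lemma unit_ballE (Z : normedModType K) (z : Z) : unit_ball z <-> nrm z <= 1.
Proof. by rewrite nrm_le1. Qed.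

Lemma delta_lt (x : nat -> X) (D : R) (f : dual X) :
  (delta x < D%:E)%E -> nrm f <= 1 ->
  exists N, forall i j, (N <= i)%N -> (N <= j)%N -> nrm (f (x i - x j)) < D.
Proof.
move=> dD f1; have : (oscillation [set f] x < D%:E)%E.
  apply: le_lt_trans dD; apply: ereal_sup_ubound; exists [set f] => //.
  by split; [exact: finite_set1|move=> _ ->; apply/unit_ballE].
by move=> /oscillation_lt[N ND]; exists N => i j Ni Nj; exact: ND.
Qed.

Lemma delta_le (x : nat -> X) (D : R) :
  (forall (f : dual X) (e : R), nrm f <= 1 -> 0 < e ->
    exists N, forall i j, (N <= i)%N -> (N <= j)%N ->
      nrm (f (x i - x j)) <= D + e) ->
  (delta x <= D%:E)%E.
Proof.
move=> xD; apply: ge_ereal_sup => _ [F [finF F1] <-].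
apply/lee_addgt0Pr => e e0; rewrite -EFinD; apply: oscillation_le.
have /choice[N NP] : forall f : dual X, exists N, F f ->
    forall i j, (N <= i)%N -> (N <= j)%N -> nrm (f (x i - x j)) <= D + e.
  move=> f; have [Ff|nFf] := pselect (F f); last by exists 0%N.
  have [|N NP] := xD f e _ e0; first exact/unit_ballE/F1.
  by exists N.
have /finite_seqP[s sF] := finF.
exists (\max_(f <- s) N f)%N => i j f Ni Nj Ff.
have fs : f \in s by move: Ff; rewrite sF.
have Nf : (N f <= \max_(f <- s) N f)%N by exact: leq_bigmax_seq.
by apply: NP => //; [exact: leq_trans Ni|exact: leq_trans Nj].
Qed.

(** If f oscillated by more than D + e on every tail, limits along one free
    ultrafilter of the two families of offending indices would be cluster
    points that f separates by D + e. *)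
Lemma delta_le_clusters (x : nat -> X) (M D : R) :
  0 <= M -> (forall n, nrm (x n) <= M) ->
  (forall phi psi, weak_star_cluster x phi -> weak_star_cluster x psi ->
    nrm (phi - psi) <= D) ->
  (delta x <= D%:E)%E.
Proof.
move=> M0 xM xD; apply: delta_le => f e f1 e0; apply: contrapT => far.
have /choice[p pP] : forall n, exists p : nat * nat,
    [/\ (n <= p.1)%N, (n <= p.2)%N & D + e < nrm (f (x p.1 - x p.2))].
  move=> n; apply: contrapT => np; apply: far; exists n => i j ni nj.
  by rewrite leNgt; apply/negP => ij; apply: np; exists (i, j).
have [U [UU oU]] := free_ultrafilter.
have [phi xphi] := @ultra_bidual R k X _ U (x \o (fst \o p)) M UU M0 (fun n => xM _).
have [psi xpsi] := @ultra_bidual R k X _ U (x \o (snd \o p)) M UU M0 (fun n => xM _).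
have cphi : weak_star_cluster x phi.
  apply: (@cluster_along R k X x (fst \o p) U) => // n.
  by have [] := pP n.
have cpsi : weak_star_cluster x psi.
  apply: (@cluster_along R k X x (snd \o p) U) => // n.
  by have [] := pP n.
have fpp : f (x (p n).1 - x (p n).2) @[n --> U] --> phi f - psi f.
  under eq_fun do rewrite linearB.
  by apply: cvgB; [exact: xphi|exact: xpsi].
have : D + e <= nrm (phi f - psi f).
  apply: (@nrm_cvg_ge R k K^o _ U (fun n => f (x (p n).1 - x (p n).2))) fpp _.
  apply: nearW => n.
  by apply: ltW; have [] := pP n.
have := xD _ _ cphi cpsi; have := blin_le_nrm (phi - psi) f.
rewrite blinBE => h1 h2 h3.
have : nrm (phi - psi) * nrm f <= nrm (phi - psi) by rewrite ler_piMr ?nrm_ge0.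
lra.
Qed.

End quantities_in_reals.

(** * Weakly compact sets of functionals *)

Section weak_sequences.
Context {R : realType} {k : scalar_kind}.
Local Notation K := (scalarField R k).

Lemma delta_cluster_near (X : normedModType K) (x : nat -> X) (D : R) phi
    (f : dual X) : (delta x < D%:E)%E -> weak_star_cluster x phi ->
  nrm f <= 1 ->
  exists N, forall n, (N <= n)%N -> nrm (f (x n) - phi f) <= D.
Proof.
move=> xD [U [UU oU xphi]] f1.
have [N ND] := delta_lt xD f1; exists N => n Nn.
have lim : f (x n) - f (x m) @[m --> U] --> f (x n) - phi f.
  by apply: cvgB; [exact: cvg_cst|exact: xphi].
apply: (@nrm_cvg_le R k K^o _ U (fun m => f (x n) - f (x m))) lim _.
have : U [set m | (N <= m)%N] by apply: oU; exists N.
by apply: filterS => m Nm; rewrite -linearB ltW// ND.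
Qed.

Variable Z : normedModType K.

(** Any functional is a scalar multiple of one in the unit ball. *)
Lemma cvg_weak_unit_ball (z : nat -> Z) (l : Z) :
  (forall f : dual Z, nrm f <= 1 -> f (z n) @[n --> \oo] --> f l) ->
  forall f : dual Z, f (z n) @[n --> \oo] --> f l.
Proof.
move=> zl f; pose a : K := scalar_of_real k (nrm f + 1)^-1.
have f1 : 0 < nrm f + 1 by rewrite ltr_wpDl ?nrm_ge0.
have a0 : a != 0 by rewrite gt_eqF// emb_gt0 invr_gt0.
have af1 : nrm (a *: f) <= 1.
  rewrite nrmZ nrm_emb ger0_norm ?invr_ge0 ?(ltW f1)//.
  by rewrite mulrC ler_pdivrMr// mul1r lerDl.
have afE x : f x = a^-1 *: ((a *: f) x : K^o).
  by rewrite [(a *: f) x](_ : _ = a *: (f x : K^o))// scalerK.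
rewrite afE; under eq_fun do rewrite afE.
by apply: cvgZl_tmp; exact: zl.
Qed.

Lemma weakly_compact_ultra (F : set Z) (T : Type) (g : T -> Z)
    (U : set_system T) : weakly_compact F -> (forall n, F (g n)) ->
  UltraFilter U ->
  exists z, F z /\ forall f : dual Z, f (g t) @[t --> U] --> f z.
Proof.
move=> cF Fg UU.
have gU := fmap_ultra (g : T -> weak Z) UU.
have gF : U (g @^-1` F) by apply: filterE => t; exact: Fg.
have [z [Fz gz]] := cF _ (@ultra_proper _ _ gU) gF.
rewrite (ultra_cvg_clusterE gU) in gz.
by exists z; split=> //; exact/(cvg_weakP g z).
Qed.

(** The half of the Eberlein-Smulian theorem saying that weak compactness
    implies weak sequential compactness.  By compactness every cluster point of
    g is evaluation at a point of F, so [subseq_clusters_close] applies with d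
    = 0 and gives a subsequence with a single cluster point. *)
Lemma weakly_compact_subseq (F : set Z) (M : R) (g : nat -> Z) :
  weakly_compact F -> 0 <= M -> (forall z, F z -> nrm z <= M) ->
  (forall n, F (g n)) ->
  exists s z, [/\ {homo s : i j / (i < j)%N}, F z &
    forall f : dual Z, f (g (s n)) @[n --> \oo] --> f z].
Proof.
move=> cF M0 FM Fg.
have [|s sh sc] := @subseq_clusters_close R k Z g M 0 M0 (fun n => FM _ (Fg n)).
  move=> phi [U [UU oU gphi]].
  have [z [Fz gz]] := weakly_compact_ultra cF Fg UU.
  exists z; rewrite (_ : phi - evaluation z = 0) ?nrm0//.
  apply/eqP; rewrite subr_eq0; apply/eqP/val_inj/funext => f.
  exact: (cvg_unique _ (gphi f) (gz f)).
have [U [UU oU]] := free_ultrafilter.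
have [z [Fz gz]] := weakly_compact_ultra cF (fun n => Fg (s n)) UU.
have cz : weak_star_cluster (g \o s) (evaluation z) by exists U.
have dz : (delta (g \o s) <= 0%:E)%E.
  apply: (@delta_le_clusters R k Z _ M) => // [n|phi psi cphi cpsi].
    exact/FM/Fg.
  by have := sc _ _ cphi cpsi; rewrite mulr0.
exists s, z; split=> //; apply: cvg_weak_unit_ball => f f1.
apply/cvg_nrmP => e e0.
have de : (delta (g \o s) < (e / 2)%:E)%E.
  by apply: le_lt_trans dz _; rewrite lte_fin divr_gt0.
have [N Ne] := delta_cluster_near de cz f1.
exists N => // n Nn /=; rewrite nrmB (le_lt_trans (Ne n Nn))//.
by rewrite ltr_pdivrMr// ltr_pMr// ltr1n.
Qed.

(** A weak neighbourhood of 0 contains all but finitely many h n, so an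
    ultrafilter on this set that does not converge to 0 lives on a finite
    subset. *)
Lemma weakly_null_compact (h : nat -> Z) :
  weakly_null h -> weakly_compact (range h `|` [set 0]).
Proof.
move=> h0.
have h0w : (h : nat -> weak Z) @ \oo --> (0 : weak Z).
  by apply/cvg_weakP => f; rewrite linear0; exact: h0.
rewrite /weakly_compact compact_ultra => U UU UA.
have [U0|nU0] := pselect (U --> (0 : weak Z)); first by exists 0; split=> //; right.
have [B [nB nUB]] : exists B, nbhs (0 : weak Z) B /\ ~ U B.
  apply: contrapT => nB; apply: nU0 => B nB0; apply: contrapT => nUB.
  by apply: nB; exists B.
have [//|UnB] := in_ultra_setVsetC B UU.
have [N _ NB] := h0w _ nB.
have UN : U (h @` `I_N).
  apply: filterS (filterI UA UnB) => _ [[[n _ <-]|->] nBn].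
    exists n => //=; rewrite ltnNge; apply/negP => Nn; apply: nBn.
    exact: NB.
  by exfalso; apply: nBn; exact: (nbhs_singleton nB).
have : compact (h @` `I_N : set (weak Z)).
  by apply: finite_compact; apply: finite_image; exact: finite_II.
rewrite compact_ultra => /(_ U UU UN) [_ [[n _ <-] Un]].
by exists (h n); split=> //; left; exists n.
Qed.

End weak_sequences.

(** * Operators on l1 *)

Section ell1_operator.
Context {R : realType} {k : scalar_kind}.
Local Notation K := (scalarField R k).
Local Notation l1 := (ell1 R k).

Section estimates.
Variable V : normedModType K.
Implicit Types (a : nat -> K^o) (y : nat -> V).

Definition wsum a y n : V := \sum_(0 <= i < n) (a i : K) *: y i.

(** Bounding only the vectors from m on serves twice: with m = 0 for the norm
    of an operator on l1, and with scalars f (y i) for tails where only a bound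
    on late terms is available. *)
Lemma wsum_diff_le a y (D : R) m n : (m <= n)%N ->
  (forall i, (m <= i)%N -> nrm (y i) <= D) ->
  nrm (wsum a y n - wsum a y m) <=
    D * (\sum_(0 <= i < n) nrm (a i) - \sum_(0 <= i < m) nrm (a i)).
Proof.
move=> mn yD; rewrite -(subnKC mn); elim: (n - m)%N => [|j IH].
  by rewrite addn0 !subrr mulr0 nrm0.
rewrite addnS /wsum !big_nat_recr//= addrAC [X in D * X]addrAC mulrDr.
rewrite (le_trans (ler_nrmD _ _))// lerD// nrmZ mulrC ler_wpM2r ?nrm_ge0//.
by apply: yD; exact: leq_addr.
Qed.

Lemma wsum_tail_le (a : l1) y (D : R) m n : (m <= n)%N -> 0 <= D ->
  (forall i, (m <= i)%N -> nrm (y i) <= D) ->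
  nrm (wsum a y n - wsum a y m) <= D * nrm a.
Proof.
move=> mn D0 yD; rewrite (le_trans (wsum_diff_le a mn yD))// ler_wpM2l//.
rewrite lerBlDr (le_trans (ell1_le_norm a n))// lerDl.
by apply: sumr_ge0 => i _; exact: nrm_ge0.
Qed.

End estimates.

Lemma wsum_linear (X Y : normedModType K) (f : blin X Y) (a : nat -> K^o) y n :
  f (wsum a y n) = wsum a (f \o y) n.
Proof. by rewrite /wsum linear_sum; apply: eq_bigr => i _; rewrite linearZ. Qed.

Variable X : completeNormedModType K.

Lemma wsum_cvg (a : l1) (y : nat -> X) (M : R) : 0 <= M ->
  (forall n, nrm (y n) <= M) -> cvgn (wsum a y).
Proof.
move=> M0 yM; apply: cauchy_cvg; apply: cauchy_exP => e e0.
have e0' : 0 < re e by rewrite -(emb_gt0 (k := k)) emb_re// ltW.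
have M1 : 0 < M + 1 by rewrite ltr_wpDl.
have e1 : 0 < re e / (M + 1) by rewrite divr_gt0.
have /cvgrPdist_lt/(_ _ e1)[N _ NP] := @ell1_cvg R k a.
exists (wsum a y N), N => // n /= Nn.
rewrite -ball_normE /= -(emb_re (ltW e0)) -emb_nrm ltr_emb nrmB.
rewrite (le_lt_trans (@wsum_diff_le _ a y M N n Nn (fun i _ => yM i)))//.
set An := \sum_(0 <= i < n) _; set AN := \sum_(0 <= i < N) _.
have AnA : An <= ell1_norm a by rewrite -nrm_ell1E; exact: ell1_le_norm.
have ANA : ell1_norm a - AN < re e / (M + 1).
  by apply: le_lt_trans (ler_norm _) (NP N _) => /=.
have ANAn : AN <= An.
  rewrite /An (big_cat_nat (leq0n N) Nn) /= lerDl.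
  by apply: sumr_ge0 => i _; exact: nrm_ge0.
have h : An - AN < re e / (M + 1) by lra.
move: h; rewrite ltr_pdivlMr// => h.
by apply: le_lt_trans h; rewrite mulrC ler_wpM2l ?subr_ge0// lerDl.
Qed.

(** The series converges absolutely because y is bounded; T sends the n-th
    basis vector of l1 to y n. *)
Lemma ell1_operator (y : nat -> X) (M : R) : 0 <= M ->
  (forall n, nrm (y n) <= M) ->
  exists T : blin l1 X, forall a : l1, wsum a y n @[n --> \oo] --> T a.
Proof.
move=> M0 yM; pose T (a : l1) : X := limn (wsum a y).
have TE (a : l1) : wsum a y n @[n --> \oo] --> T a by exact: wsum_cvg M0 yM.
have Tlin : linear T.
  move=> c a b.
  have H : c *: wsum a y n + wsum b y n @[n --> \oo] --> c *: T a + T b.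
    by apply: cvgD; [apply: cvgZl_tmp|]; exact: TE.
  have E n : wsum (c *: a + b : l1) y n = c *: wsum a y n + wsum b y n.
    rewrite /wsum scaler_sumr -big_split /=.
    by apply: eq_bigr => i _; rewrite scalerA -scalerDl.
  have Tcab := TE (c *: a + b); rewrite (funext E) in Tcab.
  exact: (cvg_unique _ Tcab H).
have TM (a : l1) : nrm (T a) <= M * nrm a.
  apply: (@nrm_cvg_le R k X _ \oo (wsum a y)) (TE a) _; apply: nearW => n.
  have := @wsum_tail_le X a y M 0 n (leq0n n) M0 (fun i _ => yM i).
  by rewrite {2}/wsum big_geq// subr0.
by exists (Blin (blin_bound Tlin TM)).
Qed.

Lemma ell1_tail_le (y : nat -> X) (T : blin l1 X) (D : R) (f : dual X) N
    (a : l1) : 0 <= D ->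
  wsum a y n @[n --> \oo] --> T a ->
  (forall n, (N <= n)%N -> nrm (f (y n)) <= D) -> nrm a <= 1 ->
  nrm (f (T a) - wsum a (f \o y) N) <= D.
Proof.
move=> D0 Ta fD a1.
have lim : wsum a (f \o y) n - wsum a (f \o y) N @[n --> \oo] -->
    f (T a) - wsum a (f \o y) N.
  apply: cvgB; last exact: cvg_cst.
  have -> : wsum a (f \o y) = f \o wsum a y.
    by apply/funext => n; rewrite /= wsum_linear.
  by apply: continuous_cvg Ta; exact: blin_continuous.
apply: (@nrm_cvg_le R k K^o _ \oo
  (fun n => wsum a (f \o y) n - wsum a (f \o y) N)) lim _.
exists N => // n /= Nn.
rewrite (le_trans (@wsum_tail_le K^o a (f \o y) D _ _ Nn D0 fD))//.
by rewrite ler_piMr.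
Qed.

(** Let phi be the limit of T a along an ultrafilter U on the unit ball of l1,
    and let b be the coordinatewise limit of a along U, which again lies in the
    unit ball of l1.  For f in the dual ball choose N such that |f (y n)| <= D
    from N on.  The parts of f (T a) and f (T b) beyond N contribute at most D
    each, and the first N terms converge to each other along U.  Hence phi is
    within 2 D of T b. *)
Lemma wk_ell1_operator (y : nat -> X) (T : blin l1 X) (D : R) : 0 <= D ->
  (forall a : l1, wsum a y n @[n --> \oo] --> T a) ->
  (forall f : dual X, nrm f <= 1 ->
    exists N, forall n, (N <= n)%N -> nrm (f (y n)) <= D) ->
  (wk_op T <= (2 * D)%:E)%E.
Proof.
move=> D0 TE fD; apply: wk_le => phi /weak_star_closureP[U [UU U1 Tphi]].
have coord n : exists b : K^o, (a : l1) n @[a --> U] --> b.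
  apply: (@ultra_bounded_cvg R k l1 U (fun a : l1 => a n) 1).
  apply: filterS U1 => a /unit_ballE a1; apply: le_trans a1.
  by rewrite nrm_ell1E ell1_norm_le.
have [b bE] := choice coord.
have b1 N : \sum_(0 <= i < N) nrm (b i) <= 1.
  have lim : \sum_(0 <= i < N) nrm ((a : l1) i) @[a --> U] -->
      \sum_(0 <= i < N) nrm (b i).
    by apply: cvg_big => [|i _]; [exact: add_continuous|exact: cvg_nrm (bE i)].
  apply/ler_addgt0Pr => e e0; move/cvgrPdist_lt : lim => /(_ e e0) lim.
  have [a [/unit_ballE a1 /= ae]] := filter_ex (filterI U1 lim).
  have := ell1_le_norm a N; move: ae; rewrite ltr_norml => /andP[_]; lra.
pose B : l1 := Ell1 (ell1_bounded b1).
have B1 : nrm B <= 1 by exact: ell1_norm_ub.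
exists (T B); apply: blin_nrm_le => f f1.
have [N ND] := fD f f1.
have lim : f (T a) - f (T B) @[a --> U] --> phi f - f (T B).
  by apply: cvgB; [exact: Tphi|exact: cvg_cst].
have head : wsum (a : l1) (f \o y) N @[a --> U] --> wsum B (f \o y) N.
  by apply: cvg_big => [|i _]; [exact: add_continuous|apply: cvgZr_tmp; exact: bE].
apply/ler_addgt0Pr => e e0.
apply: (@nrm_cvg_le R k K^o _ U (fun a => f (T a) - f (T B))) lim _.
move/cvg_nrmP : head => /(_ e e0); apply: filterS2 U1 => a /unit_ballE a1 ae.
have aD := ell1_tail_le D0 (TE a) ND a1.
have bD := ell1_tail_le D0 (TE B) ND B1.
have -> : f (T a) - f (T B) = (f (T a) - wsum a (f \o y) N) -
    (f (T B) - wsum B (f \o y) N) -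
    (wsum B (f \o y) N - wsum a (f \o y) N).
  by ring.
rewrite (le_trans (ler_nrmD _ _))// nrmN lerD ?(ltW ae)//.
rewrite (le_trans (ler_nrmD _ _))// nrmN; lra.
Qed.

End ell1_operator.

(** * The implications *)

Section limsup.
Variable R : realType.
Local Open Scope ereal_scope.

Lemma limn_esup_gt (u : nat -> \bar R) (c : \bar R) : c < limn_esup u ->
  forall N, exists2 n, (N <= n)%N & c < u n.
Proof.
move=> cu N.
have : c < ereal_sup (u @` [set n | (N <= n)%N]).
  apply: (lt_le_trans cu); apply: ereal_inf_lbound.
  by exists [set n | (N <= n)%N] => //; exists N.
by move=> /ereal_sup_gt[_ [n Nn <-] cn]; exists n.
Qed.

Lemma limn_esup_ge (u : nat -> \bar R) (c : \bar R) N :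
  (forall n, (N <= n)%N -> c <= u n) -> c <= limn_esup u.
Proof.
move=> cu; apply: le_ereal_inf_tmp => _ [A [N' _ NA] <-].
apply: le_ereal_sup_tmp; exists (u (maxn N N')).
  by exists (maxn N N') => //; apply: NA; exact: leq_maxr.
by apply: cu; exact: leq_maxl.
Qed.

End limsup.

(** Separates the ultrafilters defining points of the weak-star closure of a
    sequence into those giving terms of it and those giving cluster points. *)
Lemma ultra_bounded_principal (U : set_system nat) N :
  UltraFilter U -> U [set n | (n < N)%N] -> exists n, U [set n].
Proof.
move=> UU; elim: N => [|N IH] UN.
  by have [n] := filter_ex UN.
have [/IH //|UC] := in_ultra_setVsetC [set n | (n < N)%N] UU.
exists N; apply: filterS (filterI UN UC) => n /= [+ /negP].
by rewrite ltnS -leqNgt => nN Nn; apply/eqP; rewrite eqn_leq nN.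
Qed.

Section weakly_null_sequences.
Context {R : realType} {k : scalar_kind}.
Local Notation K := (scalarField R k).
Variable Z : normedModType K.

Lemma cvg_zero_near (u : nat -> K^o) (e : R) : u n @[n --> \oo] --> (0 : K^o) ->
  0 < e -> exists N, forall n, (N <= n)%N -> nrm (u n) < e.
Proof.
move=> /cvg_nrmP u0 e0; have [N _ NP] := u0 e e0; exists N => n Nn.
by have := NP n Nn; rewrite /= sub0r nrmN.
Qed.

Lemma weakly_null_subseq (h : nat -> Z) (s : nat -> nat) :
  {homo s : i j / (i < j)%N} -> weakly_null h -> weakly_null (h \o s).
Proof.
move=> sh h0 f A fA; have [N _ NP] := h0 f A fA; exists N => // n Nn.
by apply: NP => /=; exact: leq_trans Nn (leq_homo_id n sh).
Qed.

Lemma weakly_null_cauchy (h : nat -> Z) : weakly_null h -> weakly_cauchy h.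
Proof. by move=> h0 f; apply: cvg_cauchy; apply/cvg_ex; exists 0; exact: h0. Qed.

Lemma weakly_null_pointwise (h : nat -> dual Z) (z : Z) : weakly_null h ->
  h n z @[n --> \oo] --> (0 : K^o).
Proof. by move=> h0; exact: (h0 (evaluation z)). Qed.

Definition half_scalar : K := scalar_of_real k 2^-1.

Lemma nrm_half (V : normedModType K) (v : V) : nrm (half_scalar *: v) = 2^-1 * nrm v.
Proof. by rewrite nrmZ nrm_emb ger0_norm. Qed.

Lemma half_diff_unit_ball (V : normedModType K) (v w : V) :
  nrm v <= 1 -> nrm w <= 1 -> unit_ball (half_scalar *: (v - w)).
Proof.
move=> v1 w1; apply/unit_ballE; rewrite nrm_half.
by have := ler_nrmD v (- w); rewrite nrmN; lra.
Qed.

(** The factor one half keeps differences of points of the unit ball in the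
    unit ball. *)
Lemma weakly_cauchy_diff (z : nat -> Z) (p q : nat -> nat) : weakly_cauchy z ->
  (forall n, (n <= p n)%N) -> (forall n, (n <= q n)%N) ->
  weakly_null (fun n => half_scalar *: (z (p n) - z (q n))).
Proof.
move=> zc np nq f.
have -> : (fun n => f (half_scalar *: (z (p n) - z (q n)))) =
    fun n => half_scalar *: (f (z (p n)) - f (z (q n)) : K^o).
  by apply/funext => n; rewrite linearZ linearB.
rewrite -[X in _ --> X](scaler0 _ half_scalar); apply: cvgZl_tmp.
apply/cvg_nrmP => e e0.
have /cauchy_ballP/(_ (scalar_of_real k e)) := zc f.
rewrite emb_gt0 => /(_ e0)[[A B] [[N1 _ NA] [N2 _ NB]] AB].
exists (maxn N1 N2) => // n /=; rewrite geq_max => /andP[n1 n2].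
rewrite sub0r nrmN.
have := AB (f (z (p n)), f (z (q n))).
rewrite -ball_normE /= -emb_nrm ltr_emb; apply; split => /=.
  by apply: NA => /=; exact: leq_trans n1 (np n).
by apply: NB => /=; exact: leq_trans n2 (nq n).
Qed.

End weakly_null_sequences.

Section from_ell1.
Context {R : realType} {k : scalar_kind}.
Local Notation K := (scalarField R k).

Lemma ell1_basis (i : nat) : exists e : ell1 R k, nrm e <= 1 /\
  forall (V : normedModType K) (y : nat -> V) n, (i < n)%N -> wsum e y n = y i.
Proof.
pose d (j : nat) : K^o := (j == i)%:R.
have nd j : nrm (d j) = (j == i)%:R.
  by rewrite /nrm /d normr_nat; case: (j == i); rewrite ?re1 ?re0.
have d1 N : \sum_(0 <= j < N) nrm (d j) <= 1.
  under eq_bigr do rewrite nd.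
  have [iN|Ni] := ltnP i N.
    rewrite (bigD1_seq i) ?iota_uniq ?mem_index_iota//= eqxx big1 ?addr0//.
    by move=> j /negPf ->.
  rewrite big_nat_cond big1// => j /andP[/andP[_ jN] _].
  by rewrite (ltn_eqF (leq_trans jN Ni)).
exists (Ell1 (ell1_bounded d1)); split; first exact: ell1_norm_ub.
move=> V y n iN; rewrite /wsum (bigD1_seq i) ?iota_uniq ?mem_index_iota//=.
rewrite /d eqxx scale1r big1 ?addr0// => j /negPf ->.
by rewrite scale0r.
Qed.

Variable X : completeNormedModType K.

(** Takes the second assertion to the third.  Suppose |f n (x n)| > c for
    infinitely many n, and let d exceed the weak non-compactness of x.  Extract
    a subsequence of such n, and from it one whose cluster points are within 8
    d of one another.  With z within d of one of them, the vectors y n = x (r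
    n) - z satisfy |f (y n)| <= 10 d eventually for f in the dual ball (8 d,
    enlarged to 9 d to have a strict inequality, plus d), so the operator T
    given by the sequence y has weak non-compactness at most 20 d.  Since f (r
    n) tends to 0 at z and at each y i, the functionals f (r i) and f (r j),
    composed with T, are asymptotically c apart at the i-th basis vector. *)
Lemma ell1_operator_limsup (x : nat -> X) (f : nat -> dual X) (C : R) : 0 < C ->
  (forall T : blin (ell1 R k) X, (cc (adjoint T) <= C%:E * wk_op T)%E) ->
  bounded_fun x -> weakly_null f -> (forall n, unit_ball (f n)) ->
  (limn_esup (fun n => (nrm (f n (x n)))%:E) <= (20 * C)%:E * wk (range x))%E.
Proof.
move=> C0 HC /bounded_nrmP[M M0 xM] f0 f1.
apply: lee_mul_between => [|c d cL wd]; first by rewrite mulr_gt0.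
have [t th tc] : exists2 t : nat -> nat, {homo t : i j / (i < j)%N} &
    forall n, c < nrm (f (t n) (x (t n))).
  apply: (@extraction (fun _ m => c < nrm (f m (x m)))) => _ N.
  have [n Nn cn] := limn_esup_gt cL N.
  by exists n => //; rewrite -lte_fin.
have near_space phi : weak_star_cluster (x \o t) phi ->
    exists z : X, nrm (phi - evaluation z) < d.
  by move=> /(cluster_subseq th)/cluster_closure; exact: wk_ltP.
have [|s sh sc] := @subseq_clusters_close R k X (x \o t) M d M0 (fun n => xM _).
  by move=> phi /near_space[z /ltW zd]; exists z.
pose r := t \o s.
have rh : {homo r : i j / (i < j)%N} by move=> i j ij; exact/th/sh.
have [phi cphi] := cluster_exists M0 (fun n => xM (r n)).
have [z zd] := near_space phi (cluster_subseq sh cphi).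
have d0 : 0 < d by apply: le_lt_trans zd; exact: nrm_ge0.
have delta9 : (delta (x \o r) < (9 * d)%:E)%E.
  apply: le_lt_trans (delta_le_clusters M0 (fun n => xM (r n)) sc) _.
  by rewrite lte_fin ltr_pM2r// ltr_nat.
pose y n := x (r n) - z.
have yM n : nrm (y n) <= M + nrm z.
  by rewrite (le_trans (ler_nrmD _ _))// nrmN lerD.
have [T TE] := ell1_operator (addr_ge0 M0 (nrm_ge0 z)) yM.
have wkT : (wk_op T <= (2 * (10 * d))%:E)%E.
  apply: (wk_ell1_operator _ TE); first by rewrite mulr_ge0// ltW.
  move=> g g1; have [N NP] := delta_cluster_near delta9 cphi g1.
  exists N => n Nn; rewrite linearB /=.
  rewrite -[g (x (r n)) - g z](_ : (g (x (r n)) - phi g) +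
    (phi - evaluation z) g = _); last first.
    by rewrite blinBE /= addrA subrK.
  rewrite (le_trans (ler_nrmD _ _))// (_ : 10 * d = 9 * d + d); last by ring.
  rewrite lerD//; first exact: NP.
  by rewrite (le_trans (blin_le_nrm _ _))// (le_trans _ (ltW zd))// ler_piMr ?nrm_ge0.
have cca : (c%:E <= ca (adjoint T \o (f \o r)))%E.
  apply/lee_addgt0Pr => e e0.
  have e20 : 0 < e / 2 by rewrite divr_gt0.
  rewrite -leeBlDr//; apply: le_ereal_inf_tmp => _ [n _ <-].
  have f0r := weakly_null_subseq rh f0.
  have [N1 N1P] := cvg_zero_near (weakly_null_pointwise z f0r) e20.
  (* First i late enough for f (r i) to be small at z, then j late enough for
     f (r j) to be small at y i. *)
  pose i := maxn n N1.
  have [N2 N2P] := cvg_zero_near (weakly_null_pointwise (y i) f0r) e20.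
  pose j := maxn n N2.
  apply: le_ereal_sup_tmp; eexists.
    by exists (i, j) => //; split; exact: leq_maxl.
  rewrite -EFinB lee_fin /=.
  have [b [b1 bE]] := ell1_basis i.
  have Tb : T b = y i.
    have lim : wsum b y n @[n --> \oo] --> y i.
      apply/cvg_nrmP => e' e'0; exists i.+1 => // m /= im.
      by rewrite bE// subrr nrm0.
    exact: (cvg_unique _ (TE b) lim).
  have h := blin_le_nrm (adjoint T (f (r i)) - adjoint T (f (r j))) b.
  have hb : nrm (adjoint T (f (r i)) - adjoint T (f (r j))) * nrm b <=
    nrm (adjoint T (f (r i)) - adjoint T (f (r j))) by rewrite ler_piMr ?nrm_ge0.
  apply: le_trans hb; apply: le_trans h.
  rewrite blinBE /= Tb.
  have lb1 := nrm_subD (f (r i) (y i)) (f (r j) (y i)).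
  have lb2 := N2P j (leq_maxr _ _); rewrite /= in lb2.
  have lb3 := N1P i (leq_maxr _ _); rewrite /= in lb3.
  have lb4 := tc (s i).
  have : nrm (f (r i) (x (r i))) <= nrm (f (r i) (y i)) + nrm (f (r i) z).
    by rewrite /y linearB nrm_subD.
  by rewrite -/(r i) in lb4 *; lra.
have : (c%:E <= C%:E * (2 * (10 * d))%:E)%E.
  apply: (le_trans cca); apply: le_trans (lee_wpmul2l _ wkT); last first.
    by rewrite lee_fin ltW.
  apply: le_trans (HC T); apply: ereal_sup_ubound; exists (f \o r) => //.
  split; last by move=> n; exact: f1.
  by apply: weakly_null_cauchy; exact: weakly_null_subseq.
by rewrite -EFinM lee_fin; lra.
Qed.

End from_ell1.

Section other_implications.
Context {R : realType} {k : scalar_kind}.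
Local Notation K := (scalarField R k).

(** A point of the weak-star closure is either a term of the sequence or the
    difference of two cluster points of x, and then has norm at most delta x. *)
Lemma wk_differences (X : normedModType K) (x : nat -> X) (p q : nat -> nat)
    (d : R) :
  (forall n, (n <= p n)%N) -> (forall n, (n <= q n)%N) ->
  (delta x < d%:E)%E ->
  (wk (range (fun n => x (p n) - x (q n))%R) <= d%:E)%E.
Proof.
move=> np nq xd; apply: wk_le => phi /weak_star_closureP[U [UU _ Uphi]].
have d0 : 0 <= d.
  have [|N /(_ N N (leqnn _) (leqnn _))] := delta_lt (f := 0) xd.
    by rewrite nrm0.
  by rewrite subrr linear0 nrm0 => /ltW.
have [oU|noU] := pselect (\oo `<=` U).
  exists 0; apply: blin_nrm_le => f f1; rewrite blinBE /= linear0 subr0.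
  have [N NP] := delta_lt xd f1.
  apply: (@nrm_cvg_le R k K^o _ U (fun n => f (x (p n) - x (q n)))) (Uphi f) _.
  apply: oU; exists N => // n /= Nn; apply/ltW/NP.
    exact: leq_trans Nn (np n).
  exact: leq_trans Nn (nq n).
have [N UN] : exists N, U [set n | (n < N)%N].
  apply: contrapT => nU; apply: noU => A [N _ NA].
  have [UN|UN] := in_ultra_setVsetC [set n | (n < N)%N] UU.
    by exfalso; apply: nU; exists N.
  apply: filterS UN => n /= /negP; rewrite -leqNgt => Nn.
  exact: NA.
have [n Un] := ultra_bounded_principal UU UN.
exists (x (p n) - x (q n)); apply: blin_nrm_le => f f1.
rewrite blinBE (_ : phi f = f (x (p n) - x (q n))) ?subrr ?nrm0//.
have lim : f (x (p m) - x (q m)) @[m --> U] --> f (x (p n) - x (q n)).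
  apply: cvg_near_cst; apply: filterS Un => m -> //.
exact: (cvg_unique _ (Uphi f) lim).
Qed.

(** Takes the third assertion to the fourth.  If x oscillates by more than c on
    the weakly compact set F, there are functionals in F and arbitrarily late
    differences of terms of x at which they exceed c.  By
    [weakly_compact_subseq] the functionals g n may be assumed weakly
    convergent to some g0 in F; as g0 is a single functional, its values at the
    differences are at most delta x in the limit.  So the third assertion,
    applied to the halves of g n - g0 and to the differences, bounds (c - d) /
    2 by C d. *)
Lemma limsup_ca_rho (X : normedModType K) (x : nat -> X) (C : R) : 0 < C ->
  (forall (z : nat -> X) (h : nat -> dual X), bounded_fun z -> weakly_null h ->
    (forall n, unit_ball (h n)) ->
    (limn_esup (fun n => (nrm (h n (z n)))%:E) <= C%:E * wk (range z))%E) ->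
  bounded_fun x -> (ca_rho x <= (2 * C + 1)%:E * delta x)%E.
Proof.
move=> C0 HC /bounded_nrmP[M M0 xM].
apply: lee_mul_between => [|c d cL xd]; first by lra.
have [_ [F [cF F1] <-] cosc] := ereal_sup_gt cL.
have /choice[t tP] : forall n, exists t : nat * nat * dual X,
    [/\ (n <= t.1.1)%N, (n <= t.1.2)%N, F t.2 & c < nrm (t.2 (x t.1.1 - x t.1.2))].
  by move=> n; have [i [j [f [? ? ? ?]]]] := oscillation_gt cosc n; exists (i, j, f).
have [s [g0 [sh Fg0 sg0]]] := @weakly_compact_subseq R k (dual X) F 1
  (fun n => (t n).2) cF ler01 (fun f Ff => (unit_ballE f).1 (F1 f Ff))
  (fun n => let: And4 _ _ Ft _ := tP n in Ft).
pose p n := (t (s n)).1.1; pose q n := (t (s n)).1.2.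
have np n : (n <= p n)%N.
  by rewrite (leq_trans (leq_homo_id n sh))//; have [] := tP (s n).
have nq n : (n <= q n)%N.
  by rewrite (leq_trans (leq_homo_id n sh))//; have [] := tP (s n).
pose z n := x (p n) - x (q n).
pose g n := (t (s n)).2.
have Fg n : F (g n) by have [] := tP (s n).
pose h n : dual X := half_scalar *: (g n - g0).
have g01 : nrm g0 <= 1 by exact/unit_ballE/F1.
have zM : bounded_fun z.
  apply/bounded_nrmP; exists (M + M) => [|n]; first exact: addr_ge0.
  by rewrite (le_trans (ler_nrmD _ _))// nrmN lerD.
have h1 n : unit_ball (h n).
  by apply: half_diff_unit_ball => //; exact/unit_ballE/F1.
have h0 : weakly_null h.
  move=> f; have -> : (fun n => f (h n)) =
      fun n => half_scalar *: (f (g n) - f g0 : K^o).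
    by apply/funext => n; rewrite linearZ linearB.
  rewrite -[X in _ --> X](scaler0 _ half_scalar); apply: cvgZl_tmp.
  by rewrite -[X in _ --> X](subrr (f g0)); apply: cvgB; [exact: sg0|exact: cvg_cst].
have [N NP] := delta_lt xd g01.
have low : (((c - d) / 2)%:E <= limn_esup (fun n => (nrm (h n (z n)))%:E))%E.
  apply: (@limn_esup_ge _ _ _ N) => n Nn; rewrite lee_fin.
  have -> : h n (z n) = half_scalar *: (g n (z n) - g0 (z n) : K^o) by [].
  rewrite nrm_half mulrC ler_wpM2l// lerBlDr.
  have cn : c <= nrm (g n (z n)) by apply: ltW; have [] := tP (s n).
  have gd : nrm (g0 (z n)) <= d.
    by apply/ltW/NP; [exact: leq_trans Nn (np n)|exact: leq_trans Nn (nq n)].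
  apply: (le_trans cn); apply: (le_trans (nrm_subD _ (g0 (z n)))).
  by rewrite lerD.
have : (((c - d) / 2)%:E <= C%:E * d%:E)%E.
  apply: (le_trans low); apply: (le_trans (HC z h zM h0 h1)).
  by apply: lee_wpmul2l; [rewrite lee_fin ltW|exact: wk_differences].
rewrite -EFinM lee_fin; lra.
Qed.

(** Takes the fourth assertion to the fifth, by passing to the subsequence of
    [subseq_clusters_close]. *)
Lemma ca_rho_tilde_wk (X : normedModType K) (x : nat -> X) (C : R) : 0 < C ->
  (forall z : nat -> X, bounded_fun z -> (ca_rho z <= C%:E * delta z)%E) ->
  bounded_fun x -> (ca_rho_tilde x <= (8 * C)%:E * wk (range x))%E.
Proof.
move=> C0 HC /bounded_nrmP[M M0 xM].
apply: lee_mul_between => [|c d cL wd]; first by rewrite mulr_gt0.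
have [|s sh sc] := @subseq_clusters_close R k X x M d M0 xM.
  move=> phi /cluster_closure cphi; have [z zd] := wk_ltP wd cphi.
  by exists z; exact: ltW.
have xsM : bounded_fun (x \o s) by apply/bounded_nrmP; exists M => // n; exact: xM.
have ds : (delta (x \o s) <= (8 * d)%:E)%E.
  exact: delta_le_clusters M0 (fun n => xM (s n)) sc.
have : (c%:E <= C%:E * (8 * d)%:E)%E.
  apply: (le_trans (ltW cL)).
  apply: (@le_trans _ _ (ca_rho (x \o s))).
    by apply: ereal_inf_lbound; exists s.
  apply: (le_trans (HC _ xsM)).
  by apply: lee_wpmul2l => //; rewrite lee_fin ltW.
rewrite -EFinM lee_fin; lra.
Qed.

(** Takes the fifth assertion to the first.  If the adjoint moves two late
    terms of a weakly Cauchy sequence z more than c apart, their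
    half-difference h n exceeds c / 2 at some x n in the image of the unit
    ball.  The set of all h n together with 0 is weakly compact, so for some
    subsequence s and some N the functional h (s i) nearly identifies x (s i)
    with x (s N) when i >= N, up to C d; but h (s i) tends to 0 at the fixed
    point x (s N). *)
Lemma cc_adjoint_wk (X Y : normedModType K) (T : blin Y X) (C : R) : 0 < C ->
  (forall x : nat -> X, bounded_fun x ->
    (ca_rho_tilde x <= C%:E * wk (range x))%E) ->
  (cc (adjoint T) <= (2 * C)%:E * wk_op T)%E.
Proof.
move=> C0 HC; apply: lee_mul_between => [|c d cL wd]; first by rewrite mulr_gt0.
have [_ [z [zc z1] <-] cz] := ereal_sup_gt cL.
have /choice[t tP] : forall n, exists t : nat * nat * Y,
    [/\ (n <= t.1.1)%N, (n <= t.1.2)%N, nrm t.2 <= 1 &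
      c < nrm ((z t.1.1 - z t.1.2) (T t.2))].
  move=> n.
  have /ereal_sup_gt[_ [[i j] [/= ni nj] <-]] : (c%:E < ereal_sup
      [set (nrm ((adjoint T \o z) p.1 - (adjoint T \o z) p.2))%:E |
        p in tail_pairs n])%E.
    by apply: (lt_le_trans cz); apply: ereal_inf_lbound; exists n.
  rewrite lte_fin => cij; apply: contrapT => nt.
  move: cij; rewrite ltNge => /negP; apply; apply: blin_nrm_le => y y1.
  rewrite leNgt; apply/negP => cy; apply: nt; exists (i, j, y); split=> //.
pose x n := T (t n).2.
pose h n : dual X := half_scalar *: (z (t n).1.1 - z (t n).1.2).
have h0 : weakly_null h.
  by apply: weakly_cauchy_diff => // n; have [] := tP n.
have h1 n : unit_ball (h n).
  by apply: half_diff_unit_ball; exact/unit_ballE/z1.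
have xM : bounded_fun x.
  apply/bounded_nrmP; exists (nrm T) => [|n]; first exact: nrm_ge0.
  rewrite (le_trans (blin_le_nrm _ _))// ler_piMr ?nrm_ge0//.
  by have [] := tP n.
have wx : (wk (range x) <= wk_op T)%E.
  apply: wk_mono => _ [n _ <-]; exists (t n).2 => //.
  by apply/unit_ballE; have [] := tP n.
have /ereal_inf_lt[_ [s sh <-] sC] : (ca_rho_tilde x < (C * d)%:E)%E.
  apply: (le_lt_trans (HC x xM)); rewrite EFinM lte_pmul2l ?lte_fin//.
  exact: le_lt_trans wd.
pose F : set (dual X) := range h `|` [set 0].
have /oscillation_lt[N NP] : (oscillation F (x \o s) < (C * d)%:E)%E.
  apply: le_lt_trans sC; apply: ereal_sup_ubound; exists F => //.
  split; first exact: weakly_null_compact.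
  by move=> _ [[n _ <-]|->]; [exact: h1|apply/unit_ballE; rewrite nrm0].
(* Compare h (s i) at x (s i) with its value at the fixed point x (s N), where
   weak nullity makes it small for large i. *)
suff : c / 2 <= C * d by lra.
apply/ler_addgt0Pr => e e0.
have h0s := weakly_null_subseq sh h0.
have [N' N'P] := cvg_zero_near (weakly_null_pointwise (x (s N)) h0s) e0.
pose i := maxn N N'.
have hi := NP i N (h (s i)) (leq_maxl _ _) (leqnn N) (or_introl (imageP h I)).
have hN := N'P i (leq_maxr _ _).
have := nrm_subD (h (s i) (x (s i))) (h (s i) (x (s N))).
have -> : h (s i) (x (s i)) - h (s i) (x (s N)) = h (s i) ((x \o s) i - (x \o s) N).
  by rewrite linearB.
have lb : c / 2 <= nrm (h (s i) (x (s i))).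
  have -> : h (s i) (x (s i)) =
    half_scalar *: ((z (t (s i)).1.1 - z (t (s i)).1.2) (x (s i)) : K^o) by [].
  by rewrite nrm_half mulrC ler_wpM2l// ltW//; have [] := tP (s i).
rewrite /= in hN; lra.
Qed.

End other_implications.

Local Open Scope ereal_scope.

Theorem theorem5p5 (R : realType) (k : scalar_kind)
    (X : completeNormedModType (scalarField R k)) :
  [<->
    exists2 C : R, (0 < C)%R &
      forall (Y : completeNormedModType (scalarField R k)) (T : blin Y X),
        cc (adjoint T) <= C%:E * wk_op T ;
    exists2 C : R, (0 < C)%R &
      forall T : blin (ell1 R k) X,
        cc (adjoint T) <= C%:E * wk_op T ;
    exists2 C : R, (0 < C)%R &
      forall (x : nat -> X) (f : nat -> dual X),
        bounded_fun x -> weakly_null f -> (forall n, unit_ball (f n)) ->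
        limn_esup (fun n => (nrm (f n (x n)))%:E) <= C%:E * wk (range x) ;
    exists2 C : R, (0 < C)%R &
      forall x : nat -> X, bounded_fun x ->
        ca_rho x <= C%:E * delta x ;
    exists2 C : R, (0 < C)%R &
      forall x : nat -> X, bounded_fun x ->
        ca_rho_tilde x <= C%:E * wk (range x)
  ].
Proof.
tfae=> -[C C0 HC].
- by exists C => // T; exact: HC.
- exists (20 * C)%R => [|x f xM f0 f1]; first by rewrite mulr_gt0.
  exact: ell1_operator_limsup.
- exists (2 * C + 1)%R => [|x xM]; first by lra.
  exact: limsup_ca_rho.
- exists (8 * C)%R => [|x xM]; first by rewrite mulr_gt0.
  exact: ca_rho_tilde_wk.
- exists (2 * C)%R => [|Y T]; first by rewrite mulr_gt0.
  exact: cc_adjoint_wk.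
Qed.
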